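(* Let $\mathcal{T}_h$ be a mesh satisfying the smallness condition $$h<\min\left\{ \frac{\sqrt{\bar{\kappa}}}{\sqrt{2}\,(1+(1-2\epsilon^2)^{-3/2})\,\kappa},\ \frac{\epsilon}{\kappa}\right\}$$ for fixed $\epsilon\in(0,\sqrt2/2)$ and $\bar\kappa\in(0,1]$, where additionally: in the bilinear case $\sqrt{\bar\kappa}<\frac{1}{4\sqrt2}$; in the rotated-$Q_1$ case $\sqrt{\bar{\kappa}} \leq \frac{\rho(1- \lambda)}{4 - (3 + \lambda)\rho}$ for some $\lambda\in(0,1)$ (no additional restriction on $\bar\kappa\in(0,1]$ in the linear and Crouzeix-Raviart cases). Let $T\in\mathcal{T}_h^i$ be an interface element and let $F\in\Gamma\cap T$ be chosen as follows: in the linear and Crouzeix-Raviart cases, such that $\mathbf{n}(F)=\bar{\mathbf n}$; in the bilinear case, such that its orthogonal projection $F_\bot$ onto $l$ is the midpoint of the segment $\overline{DE}$; in the rotated-$Q_1$ case, arbitrary. Then, given any vector $v=(v_i)_{i\in\mathcal I}$ (in $\mathbb{R}^4$ for the bilinear and rotated-$Q_1$ cases, in $\mathbb{R}^3$ for the linear and Crouzeix-Raviart cases), there exists one and only one function $\phi^P_T$ of the form $\phi_T^P=\phi_T^-\in\Pi_T$ on $T^-$, $\phi_T^P=\phi_T^+\in\Pi_T$ on $T^+$, such that (a) $\phi_T^-|_l=\phi_T^+|_l$, and, if $T$ is rectangular, also $d(\phi_T^-)=d(\phi_T^+)$; (b) $\beta^-\nabla\phi_T^-(F)\cdot\mathbf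 n(F)=\beta^+\nabla\phi_T^+(F)\cdot\mathbf n(F)$; (c) $\phi_T^P(M_i)=v_i$ for all $i\in\mathcal I$.
   Context: Mesh and interface. $\Omega\subset\mathbb R^2$ is a bounded domain that is a union of finitely many rectangles; a curve $\Gamma$ separates $\Omega$ into subdomains $\Omega^-,\Omega^+$. $\mathcal T_h$ is a Cartesian triangular or rectangular mesh of $\Omega$ with maximum edge length $h$; a typical element has vertices $A_1=(0,0),A_2=(h,0),A_3=(h,h)$ (triangle), or additionally $A_4=(0,h)$ (rectangle). An element whose interior meets $\Gamma$ is an interface element; $\mathcal T_h^i$ is the set of these. Standing hypotheses: $\Gamma$ meets an edge of an element in at most two points unless the edge is part of $\Gamma$; if $\Gamma$ meets the boundary of an element at two points, these are on different edges; $\Gamma$ is piecewise $C^2$, and its portion in each interface element is $C^2$. For $T\in\mathcal T_h^i$: $T^s=T\cap\Omega^s$, $s=\pm$; $D,E$ are the intersection points of $\Gamma$ with $\partial T$; $l$ is the line through $D$ and $E$ with unit normal $\bar{\mathbf n}$; $\mathbf n(\widetilde X)$ is the unit normal of $\Gamma$ at $\widetilde X\in\Gamma\cap T$; all normals are oriented from $T^-$ to $T^+$. In the local coordinates with origin $D$ and first axis along $l$, $\Gamma\cap T$ is a graph $\{(\xi,\omega(\xi)):\xi\in[0,\xi_E]\}$, where $E=(\xi_E,0)$. $\kappa$ is the maximum curvature of $\Gamma$. Coefficients: $\beta^\pm>0$ are constants with $\beta^+\ge\beta^-$, and $\rho=\beta^-/\beta^+\le 1$. Finite elements: $\Pi_T=\mathrm{Span}\{1,x,y\}$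 (linear $P_1$ or Crouzeix-Raviart, triangles), $\mathrm{Span}\{1,x,y,xy\}$ (bilinear $Q_1$, rectangles), or $\mathrm{Span}\{1,x,y,x^2-y^2\}$ (rotated-$Q_1$, rectangles). $\mathcal I=\{1,2,3\}$ for triangles and $\{1,2,3,4\}$ for rectangles. The nodes $M_i$, $i\in\mathcal I$, are the vertices of $T$ for the linear and bilinear cases, and the midpoints of the edges of $T$ for the Crouzeix-Raviart and rotated-$Q_1$ cases. $\mathcal I$ is partitioned into $\mathcal I^\pm=\{i: M_i\in T^\pm\}$. For $p\in\Pi_T$, $T$ rectangular, $d(p)$ is the coefficient of its second degree term ($xy$, resp. $x^2-y^2$). *)

(* Defs.v *)
From HB Require Import structures.
From mathcomp Require Import all_boot all_order all_algebra.
From mathcomp Require Import all_classical all_reals all_analysis.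

Set Implicit Arguments.
Unset Strict Implicit.
Unset Printing Implicit Defensive.

Import Order.TTheory GRing.Theory Num.Theory.
Import numFieldNormedType.Exports.

Local Open Scope classical_set_scope.
Local Open Scope ring_scope.

Section PlaneGeometry.
Context {R : realType}.

Implicit Types (P Q X O t n D E F : R * R) (C Omega Gamma Om Op : set (R * R)).

Definition dot P Q : R := P.1 * Q.1 + P.2 * Q.2.

Definition enorm P : R := Num.sqrt (dot P P).

Definition midpoint P Q : R * R := 2^-1 *: (P + Q).

Definition segment P Q : set (R * R) :=
  [set P + s *: (Q - P) | s in `[0, 1]].

Definition line P Q : set (R * R) := [set P + s *: (Q - P) | s in [set: R]].

Definition proj_line D E F : R * R :=
  D + (dot (F - D) (E - D) / dot (E - D) (E - D)) *: (E - D).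

Definition C2 (w : R -> R) : Prop :=
  (forall x, derivable w x 1 /\ derivable (derive1 w) x 1) /\
  continuous (derive1 (derive1 w)).

(* [C] is the graph of a function that is C^2 up to the endpoints of [0, L],
   in the orthonormal frame (O; t, n).  Such a function is the restriction of
   a C^2 function on the whole line, and this is how it is given here; its
   derivatives at 0 and L do not depend on the extension. *)
Definition C2_graph C O t n (L : R) (w : R -> R) : Prop :=
  [/\ dot t t = 1 /\ dot n n = 1, dot t n = 0, 0 < L, C2 w &
      C = [set O + s *: t + w s *: n | s in `[0, L]] ].

(* A regular C^2 arc is a finite chain of C^2 graphs, so pieces can be taken to
   be graphs. *)
Definition piecewise_C2_curve Gamma : Prop :=
  exists (m : nat) (s : nat -> R) (g : R -> R * R),
    [/\ {within `[s 0%N, s m], continuous g},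
        Gamma = g @` `[s 0%N, s m] &
        forall i, (i < m)%N -> s i < s i.+1 /\
          exists O t n L w, C2_graph (g @` `[s i, s i.+1]) O t n L w ].

Definition curvatures Gamma : set R :=
  [set k | exists C O t n L w s,
     [/\ C2_graph C O t n L w, C `<=` Gamma, s \in `[0, L] &
         k = `|derive1 (derive1 w) s| / (1 + derive1 w s ^+ 2) `^ (3 / 2)] ].

Definition max_curvature Gamma (kappa : R) : Prop :=
  curvatures Gamma kappa /\ ubound (curvatures Gamma) kappa.

(* The tangential direction is the limit of the secant directions, hence a
   normal n satisfies n . (Y - X) = o(|Y - X|) as Y tends to X along C. *)
Definition unit_normal C X n : Prop :=
  dot n n = 1 /\
  forall e : R, 0 < e ->
    \forall Y \near X, C Y -> `|dot n (Y - X)| <= e * enorm (Y - X).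

Definition rectangle (r : R * R * R * R) : set (R * R) :=
  let: (a, b, c, d) := r in [set X | a <= X.1 <= b /\ c <= X.2 <= d].

Definition rectangular_domain Omega : Prop :=
  (exists rs : seq (R * R * R * R),
     (forall a b c d : R, (a, b, c, d) \in rs -> a < b /\ c < d) /\
     Omega = [set X | exists2 r, r \in rs & rectangle r X]) /\
  interior Omega !=set0 /\ connected (interior Omega).

(* [Omega] is read as the closed region, because nodes on its outer boundary
   must belong to one of the two subdomains; [separated] makes the subdomains
   relatively open in the complement of [Gamma]. *)
Definition separates Gamma Omega Om Op : Prop :=
  [/\ Omega `\` Gamma = Om `|` Op, separated Om Op,
      Om !=set0 /\ Op !=set0, connected Om & connected Op].

End PlaneGeometry.

Inductive fe_family := LinearP1 | CrouzeixRaviart | Bilinear | RotatedQ1.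

Definition is_rect (fam : fe_family) : bool :=
  match fam with Bilinear | RotatedQ1 => true | _ => false end.

(* The number of vertices, of edges, of nodes, and the dimension of the local
   polynomial space: 3 for triangles, 4 for rectangles. *)
Definition nloc (fam : fe_family) : nat := (2 + is_rect fam).+1.

Section Mesh.
Context {R : realType}.

Definition ref_vertex (i : nat) : R * R :=
  match i with 0 => (0, 0) | 1 => (1, 0) | 2 => (1, 1) | _ => (0, 1) end.

Implicit Types (T : R * R * bool * bool) (h : R) (fam : fe_family).

(* An element (P, sx, sy) is the typical element of legs h, with its first
   (second) coordinate negated if sx (sy) holds, translated by P.  This gives the
   four triangles obtained by cutting a grid cell along either diagonal. *)
Definition vertex fam h T (i : 'I_(nloc fam)) : R * R :=
  let: (P, sx, sy) := T in
  (P.1 + (-1) ^+ sx * h * (ref_vertex i).1,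
   P.2 + (-1) ^+ sy * h * (ref_vertex i).2).

Definition edge fam h T (i : 'I_(nloc fam)) : set (R * R) :=
  segment (vertex h T i) (vertex h T (ordS i)).

Definition elt_set fam h T : set (R * R) :=
  [set X | exists a : 'I_(nloc fam) -> R,
     [/\ forall i, 0 <= a i, \sum_i a i = 1 &
         X = \sum_i a i *: vertex h T i] ].

Definition elt_boundary fam h T : set (R * R) :=
  [set X | exists i, @edge fam h T i X].

Definition node fam h T (i : 'I_(nloc fam)) : R * R :=
  match fam with
  | LinearP1 | Bilinear => fun A : 'I_(nloc fam) -> R * R => A i
  | CrouzeixRaviart | RotatedQ1 => fun A => midpoint (A i) (A (ordS i))
  end (vertex h T).

Definition cartesian_mesh fam h (G : R * R) (Omega : set (R * R))
    (Th : seq (R * R * bool * bool)) : Prop :=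
  [/\ 0 < h,
      forall P sx sy, (P, sx, sy) \in Th ->
        exists i j : int, P = (G.1 + i%:~R * h, G.2 + j%:~R * h),
      forall T T', T \in Th -> T' \in Th -> T != T' ->
        interior (elt_set fam h T) `&` interior (elt_set fam h T') = set0 &
      Omega = [set X | exists2 T, T \in Th & elt_set fam h T X] ].

Definition interface_element fam h (Gamma : set (R * R)) T : Prop :=
  interior (elt_set fam h T) `&` Gamma !=set0.

Definition cuts_at fam h (Gamma : set (R * R)) T (D E : R * R) : Prop :=
  D != E /\ Gamma `&` elt_boundary fam h T = [set D; E].

Definition interface_hypotheses fam h (Gamma : set (R * R))
    (Th : seq (R * R * bool * bool)) : Prop :=
  [/\ forall T, T \in Th -> forall i : 'I_(nloc fam),
        edge h T i `<=` Gamma \/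
        exists P Q, Gamma `&` edge h T i `<=` [set P; Q],
      forall T D E, T \in Th -> cuts_at fam h Gamma T D E ->
        exists i j : 'I_(nloc fam), [/\ i != j, edge h T i D & edge h T j E],
      piecewise_C2_curve Gamma &
      forall T D E, T \in Th -> interface_element fam h Gamma T ->
        cuts_at fam h Gamma T D E ->
        exists n omega,
          C2_graph (Gamma `&` elt_set fam h T) D
            ((enorm (E - D))^-1 *: (E - D)) n (enorm (E - D)) omega ].

(* n is normal to the line DE and crosses the part of Gamma inside T from Om
   to Op. *)
Definition oriented_line_normal fam h (Gamma Om Op : set (R * R)) T
    (D E n : R * R) : Prop :=
  [/\ dot n n = 1, dot n (E - D) = 0 &
      forall X, interior (elt_set fam h T) X -> Gamma X ->
        \forall t \near 0^'+, Om (X - t *: n) /\ Op (X + t *: n) ].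

(* kappa multiplies h instead of dividing the bounds, which gives the intended
   meaning (no restriction) when kappa = 0. *)
Definition smallness (h eps kbar kappa : R) : Prop :=
  h * kappa <
  Num.min (Num.sqrt kbar /
             (Num.sqrt 2 * (1 + (1 - 2 * eps ^+ 2) `^ (- (3 / 2)))))
          eps.

Definition kbar_restriction fam (rho kbar : R) : Prop :=
  match fam with
  | LinearP1 | CrouzeixRaviart => True
  | Bilinear => Num.sqrt kbar < (4 * Num.sqrt 2)^-1
  | RotatedQ1 => exists2 lambda : R, 0 < lambda < 1 &
      Num.sqrt kbar <= rho * (1 - lambda) / (4 - (3 + lambda) * rho)
  end.

Definition admissible_F fam (D E nbar F nF : R * R) : Prop :=
  match fam with
  | LinearP1 | CrouzeixRaviart => nF = nbar
  | Bilinear => proj_line D E F = midpoint D E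
  | RotatedQ1 => True
  end.

Definition monomial fam (j : nat) (X : R * R) : R :=
  match j with
  | 0 => 1
  | 1 => X.1
  | 2 => X.2
  | _ => match fam with
         | Bilinear => X.1 * X.2
         | RotatedQ1 => X.1 ^+ 2 - X.2 ^+ 2
         | _ => 0
         end
  end.

(* Elements of the local space are given by their coefficients on the basis
   [monomial]; the coefficient d(p) of the second degree term is the last one. *)
Definition peval fam (p : 'rV[R]_(nloc fam)) (X : R * R) : R :=
  \sum_(j < nloc fam) p 0 j * monomial fam j X.

Definition dcoef fam (p : 'rV[R]_(nloc fam)) : R := p 0 ord_max.

Definition grad (f : R * R -> R) (X : R * R) : R * R :=
  (derive1 (fun s => f (s, X.2)) X.1, derive1 (fun s => f (X.1, s)) X.2).

(* Points of Gamma are given the value of the + piece; this choice plays no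
   role, as the only nodes that can lie on Gamma are D and E, where both pieces
   agree. *)
Definition glue fam (Om : set (R * R))
    (phi : 'rV[R]_(nloc fam) * 'rV[R]_(nloc fam)) (X : R * R) : R :=
  if X \in Om then peval phi.1 X else peval phi.2 X.

Definition ife_function fam h (bm bp : R) (Om : set (R * R)) T
    (D E F nF : R * R) (v : 'rV[R]_(nloc fam))
    (phi : 'rV[R]_(nloc fam) * 'rV[R]_(nloc fam)) : Prop :=
  [/\ forall X, line D E X -> peval phi.1 X = peval phi.2 X,
      is_rect fam -> dcoef phi.1 = dcoef phi.2,
      bm * dot (grad (peval phi.1) F) nF = bp * dot (grad (peval phi.2) F) nF &
      forall i, glue Om phi (node h T i) = v 0 i].

End Mesh.

(* Main.v *)
Require Import Defs.
From HB Require Import structures.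
From mathcomp Require Import all_boot all_order all_algebra.
From mathcomp Require Import all_classical all_reals all_analysis.
From mathcomp Require Import ring lra.
Import Order.TTheory GRing.Theory Num.Theory.
Import numFieldNormedType.Exports.
Local Open Scope classical_set_scope.
Local Open Scope ring_scope.

(* Proof idea.  Let L(X) = nbar . (X - D).  Condition (a) says that phi^- - phi^+ is a
   multiple c L of L.  A normal line through a point of Gamma inside T, followed by the
   edges of T, shows that the nodes in T^- have L <= 0 and all others L >= 0, so that (c)
   reads: phi^+ + c q interpolates v, where q is the interpolant of min(L, 0).  Plugging
   this into (b) leaves one linear equation for c, whose coefficient is
   K = beta^- nbar.n(F) + (beta^+ - beta^-) grad q(F).n(F).  Everything reduces to K > 0.

   For P1 and Crouzeix-Raviart elements n(F) = nbar and grad q . nbar >= 0 because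
   t |-> min(t, 0) is nondecreasing.  In the other two cases one needs that Gamma is almost
   straight in T: omega' vanishes somewhere by Rolle and omega' / sqrt(1 + omega'^2) has the
   curvature as derivative, so the smallness of h gives |omega'| <= sqrt kbar.  For Q1 this
   still yields grad q(F) . n(F) >= 0 when F lies above the midpoint of DE; for rotated Q1
   it yields grad q(F) . n(F) >= - (7/2) sqrt kbar (nbar . n(F)), which the restriction on
   kbar makes harmless. *)

(** * The geometry of an element *)

(** The equation for c is scalar because L has no second degree term and enters (c) only through
    min(L, 0). Nodes on the line itself are harmless: L = min(L, 0) = 0 there, so weak signs of L at
    the nodes suffice. The obstacle for Q1 and rotated Q1 is that grad q varies with the point while
    n(F) is tilted against nbar, so monotonicity alone no longer settles the sign. Origin of the
    constants: T has diameter at most sqrt 2 h and 1 + (1 - 2 eps^2)^(-3/2) >= 2, so the sine of the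
    slope angle is at most sqrt kbar / 2; the spare factor 2 pays for passing from sine to tangent.
    For Q1, 4 sqrt 2 >= 5 turns the restriction into the bound 1/5 on the tilt and on the offset of
    F in units of h. For rotated Q1, 7/2 = 3/2 + 2: 3/2 >= sqrt 2 bounds the offset of F from DE and
    2 the effect of the tilt; K > 0 then needs (7/2) sqrt kbar (1 - rho) < rho, and the restriction
    gives this even with 4 in place of 7/2. *)

Section Element.
Context {R : realType}.
Implicit Types (T : R * R * bool * bool) (h : R) (fam : fe_family) (X Y : R * R).

(** Inverse of the affine map from the reference element with vertices [ref_vertex]; each sign is
    its own inverse. *)
Definition ref_coord h T X : R * R :=
  let: (P, sx, sy) := T in
  ((-1) ^+ sx * (X.1 - P.1) / h, (-1) ^+ sy * (X.2 - P.2) / h).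

(** Affine form that vanishes on edge [i] and is positive inside [T]. On a triangle the forms 0, 1,
    2 are the barycentric coordinates of the vertices 2, 0, 1; index 3 is an edge of rectangles
    only. *)
Definition edge_form fam h T (i : nat) X : R :=
  let Z := ref_coord h T X in
  match i with
  | 0 => Z.2 | 1 => 1 - Z.1
  | 2 => if is_rect fam then 1 - Z.2 else Z.1 - Z.2
  | _ => Z.1
  end.

Lemma sqr_sign (b : bool) : (-1) ^+ b * (-1) ^+ b = 1 :> R.
Proof. by rewrite -expr2 sqrr_sign. Qed.

Lemma edge_form_affine fam h T i X Y (s : R) :
  edge_form fam h T i (X + s *: (Y - X)) =
  (1 - s) * edge_form fam h T i X + s * edge_form fam h T i Y.
Proof.
case: T => [[[p1 p2] sx] sy]; case: X Y => [x1 x2] [y1 y2].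
rewrite /edge_form /= -![_ *: _]/(_ * _).
by case: (is_rect fam) i => [] [|[|[|i]]] /=; ring.
Qed.

Lemma big_ord3 (V : nmodType) (F : 'I_3 -> V) :
  \sum_(i < 3) F i = F 0 + F 1 + F 2%:R.
Proof.
rewrite !big_ord_recl big_ord0 addr0 addrA.
by congr (_ + F _ + F _); apply/val_inj.
Qed.

Lemma big_ord4 (V : nmodType) (F : 'I_4 -> V) :
  \sum_(i < 4) F i = F 0 + F 1 + F 2%:R + F 3%:R.
Proof.
rewrite !big_ord_recl big_ord0 addr0 !addrA.
by congr (_ + F _ + F _ + F _); apply/val_inj.
Qed.

Lemma ref_coordK h T X : h != 0 ->
  X = let: (P, sx, sy) := T in
      (P.1 + (-1) ^+ sx * h * (ref_coord h T X).1,
       P.2 + (-1) ^+ sy * h * (ref_coord h T X).2).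
Proof.
case: T => [[[p1 p2] sx] sy]; case: X => x y h0 /=.
congr (_, _).
- transitivity (p1 + ((-1) ^+ sx * (-1) ^+ sx) * (x - p1) * (h / h)); last by ring.
  by rewrite sqr_sign divff //; ring.
- transitivity (p2 + ((-1) ^+ sy * (-1) ^+ sy) * (y - p2) * (h / h)); last by ring.
  by rewrite sqr_sign divff //; ring.
Qed.

Lemma ref_coord_vertex fam h T i : h != 0 ->
  ref_coord h T (@vertex R fam h T i) = ref_vertex i.
Proof.
case: T => [[[p1 p2] sx] sy] h0 /=.
rewrite [RHS]surjective_pairing; congr (_, _).
- transitivity (((-1) ^+ sx * (-1) ^+ sx) * (h / h) * (@ref_vertex R i).1); first by ring.
  by rewrite sqr_sign divff //; ring.
- transitivity (((-1) ^+ sy * (-1) ^+ sy) * (h / h) * (@ref_vertex R i).2); first by ring.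
  by rewrite sqr_sign divff //; ring.
Qed.

Lemma edge_form_linear fam h T i :
  exists c u1 u2 : R, forall X, edge_form fam h T i X = c + u1 * X.1 + u2 * X.2.
Proof.
have aff (f : R * R -> R) c u1 u2 :
    (forall X, f X = c + u1 * X.1 + u2 * X.2) ->
  exists c u1 u2 : R, forall X, f X = c + u1 * X.1 + u2 * X.2.
  by move=> H; exists c, u1, u2.
case: T => [[[p1 p2] sx] sy]; rewrite /edge_form /=.
pose ax : R := (-1) ^+ sx / h; pose ay : R := (-1) ^+ sy / h.
case: (is_rect fam) i => [] [|[|[|i]]].
- by apply: (aff _ (- ay * p2) 0 ay) => X; rewrite /ay; ring.
- by apply: (aff _ (1 + ax * p1) (- ax) 0) => X; rewrite /ax; ring.
- by apply: (aff _ (1 + ay * p2) 0 (- ay)) => X; rewrite /ay; ring.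
- by apply: (aff _ (- ax * p1) ax 0) => X; rewrite /ax; ring.
- by apply: (aff _ (- ay * p2) 0 ay) => X; rewrite /ay; ring.
- by apply: (aff _ (1 + ax * p1) (- ax) 0) => X; rewrite /ax; ring.
- by apply: (aff _ (- ax * p1 + ay * p2) ax (- ay)) => X; rewrite /ax /ay; ring.
- by apply: (aff _ (- ax * p1) ax 0) => X; rewrite /ax; ring.
Qed.

Lemma edge_form_vertex_ge0 fam h T (i : nat) (j : 'I_(nloc fam)) : h != 0 ->
  0 <= edge_form fam h T i (vertex h T j).
Proof.
move=> h0; rewrite /edge_form ref_coord_vertex //.
case: fam j => -[[|[|[|[|//]]]] lj] /=; case: i => [|[|[|i]]] //=; lra.
Qed.

(** Turns the convex hull into an intersection of half-planes. Backwards, the weights are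
    barycentric coordinates on triangles and Q1 shape functions on rectangles. *)
Lemma elt_setP fam h T X : h != 0 ->
  elt_set fam h T X <-> forall i : 'I_(nloc fam), 0 <= edge_form fam h T i X.
Proof.
move=> h0; split.
  move=> [a [a_ge0 a1 ->]] i.
  have [c [u1 [u2 fE]]] := edge_form_linear fam h T i.
  have -> : edge_form fam h T i (\sum_j a j *: vertex h T j) =
      \sum_j a j * edge_form fam h T i (vertex h T j).
    rewrite fE !raddf_sum /= -[c]mulr1 -a1 !mulr_sumr -!big_split /=.
    by apply: eq_bigr => j _; rewrite fE -![_ *: _]/(_ * _); ring.
  by apply: sumr_ge0 => j _; rewrite mulr_ge0 ?edge_form_vertex_ge0.
move=> X_ge0.
have := ref_coordK h T X h0; move: X_ge0.
rewrite /edge_form; case: (ref_coord h T X) => x y /=.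
case: T => [[[p1 p2] sx] sy] /= X_ge0 ->.
have eq_pair (A B : R * R) : A.1 = B.1 -> A.2 = B.2 -> A = B.
  by case: A B => [? ?] [? ?] /= -> ->.
case: fam X_ge0 => X_ge0; have y0 := X_ge0 0; have x1 := X_ge0 1;
  have yx := X_ge0 2%:R; rewrite /= in y0 x1 yx.
1,2: exists (fun i : 'I_3 => match val i with 0 => 1 - x | 1 => x - y | _ => y end).
1,2: split; [by case=> -[|[|[|//]]] lj | by rewrite big_ord3 /=; ring |].
1,2: by rewrite big_ord3; apply: eq_pair; rewrite /= -![_ *: _]/(_ * _); ring.
all: have x0 := X_ge0 3%:R; rewrite /= in x0.
all: exists (fun i : 'I_4 => match val i with
  0 => (1 - x) * (1 - y) | 1 => x * (1 - y) | 2 => x * y | _ => (1 - x) * y end).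
all: split; [by case=> -[|[|[|[|//]]]] lj /=; rewrite mulr_ge0
            | by rewrite big_ord4 /=; ring |].
all: by rewrite big_ord4; apply: eq_pair; rewrite /= -![_ *: _]/(_ * _); ring.
Qed.

Lemma edgeP fam h T (i : 'I_(nloc fam)) X : h != 0 ->
  edge h T i X <-> elt_set fam h T X /\ edge_form fam h T i X = 0.
Proof.
move=> h0.
have fs (s : R) Y Z j : edge_form fam h T j (Y + s *: (Z - Y)) =
  (1 - s) * edge_form fam h T j Y + s * edge_form fam h T j Z.
  exact: edge_form_affine.
split.
  case=> s; rewrite /= in_itv /= => /andP[s0 s1] <-; split.
    apply/elt_setP => // j; rewrite fs.
    by rewrite addr_ge0 // mulr_ge0 ?edge_form_vertex_ge0 // subr_ge0.
  rewrite fs /edge_form !ref_coord_vertex //.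
  by case: fam i {fs} => -[[|[|[|[|//]]]] lj] //=; ring.
move=> [/(elt_setP _ _ _ _ h0)]; rewrite /edge /segment /= => X_ge0 Xi.
have {1}-> := ref_coordK h T X h0.
have VE (j : 'I_(nloc fam)) := ref_coordK h T (vertex h T j) h0.
rewrite (VE i) (VE (ordS i)) !ref_coord_vertex //.
move: X_ge0 Xi; rewrite /edge_form; case: (ref_coord h T X) => x y /=.
case: T {VE fs} => [[[p1 p2] sx] sy] /= X_ge0 Xi.
have eq_pair (A B : R * R) : A.1 = B.1 -> A.2 = B.2 -> A = B.
  by case: A B => [? ?] [? ?] /= -> ->.
have inseg (s : R) : 0 <= s -> s <= 1 -> s \in `[0, 1].
  by move=> s0 s1; rewrite in_itv /= s0.
have y0 := X_ge0 0; have x1 := X_ge0 1; have yx := X_ge0 2%:R.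
case: fam i X_ge0 Xi y0 x1 yx => i X_ge0 Xi y0 x1 yx; rewrite /= in y0 x1 yx.
3,4: have x0 := X_ge0 3%:R; rewrite /= in x0.
all: case: i Xi => -[|[|[|[|//]]]] li //= Xi.
(* Vanishing of the form fixes one coordinate; the other one, or 1 minus it on edges traversed
   backwards, is the parameter on the edge. *)
all: first
  [ (have -> : y = 0 by lra); exists x
  | (have -> : x = 1 by lra); exists y
  | (have -> : y = x by lra); exists (1 - x)
  | (have -> : y = 1 by lra); exists (1 - x)
  | (have -> : x = 0 by lra); exists (1 - y)].
all: try by apply: inseg; lra.
all: by apply: eq_pair; rewrite /= -![_ *: _]/(_ * _); ring.
Qed.

End Element.

(** * Segments, rays and the interior of an element *)

Section Segments.
Context {R : realType}.
Implicit Types (T : R * R * bool * bool) (h : R) (fam : fe_family) (X Y : R * R).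

Lemma dotDr X Y (Z : R * R) : dot X (Y + Z) = dot X Y + dot X Z.
Proof. by rewrite /dot /=; ring. Qed.

Lemma dotNr X Y : dot X (- Y) = - dot X Y.
Proof. by rewrite /dot /=; ring. Qed.

Lemma dotZr X Y (s : R) : dot X (s *: Y) = s * dot X Y.
Proof. by rewrite /dot /= -![_ *: _]/(_ * _); ring. Qed.

Lemma dotC X Y : dot X Y = dot Y X.
Proof. by rewrite /dot mulrC [X.2 * _]mulrC. Qed.

Lemma dotNl X Y : dot (- X) Y = - dot X Y.
Proof. by rewrite dotC dotNr dotC. Qed.

Lemma continuous_line X Y : continuous (fun s : R => X + s *: Y).
Proof.
move=> s; apply: cvgD; first exact: cvg_cst.
by apply: cvgZr_tmp; exact: cvg_id.
Qed.

Lemma separated_segment (A B : set (R * R)) X Y : separated A B ->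
  (forall s : R, 0 <= s <= 1 -> A (X + s *: (Y - X)) \/ B (X + s *: (Y - X))) ->
  A X -> A Y.
Proof.
move=> sepAB sAB AX.
pose C := [set X + s *: (Y - X) | s in `[0, 1]] : set (R * R).
have CX : C X by exists 0; rewrite /= ?in_itv /= ?lexx ?ler01 // scale0r addr0.
have CY : C Y.
  by exists 1; rewrite /= ?in_itv /= ?lexx ?ler01 // scale1r addrC subrK.
have cC : connected C.
  apply: connected_continuous_connected; first exact: segment_connected.
  by apply: continuous_subspaceT; exact: continuous_line.
have sC : C `<=` A `|` B.
  by move=> _ [s /= s01 <-]; apply: sAB; rewrite in_itv /= in s01.
have [CA|CB] := connected_subset sepAB sC cC; first exact: CA.
have := separated_disjoint sepAB; rewrite predeqE => /(_ X)[+ _].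
by case; split => //; exact: CB.
Qed.

Lemma edge_form_shift fam h T i X Y (s : R) :
  edge_form fam h T i (X + s *: Y) =
  edge_form fam h T i X + s * (edge_form fam h T i Y - edge_form fam h T i 0).
Proof.
have [c [u1 [u2 fE]]] := edge_form_linear fam h T i.
by rewrite !fE /= -![_ *: _]/(_ * _); ring.
Qed.

(** A direction along which no form decreases would keep a ray in the bounded set [T] forever. *)
Lemma edge_form_slope fam h T Y : h != 0 -> Y != 0 ->
  exists i : 'I_(nloc fam), edge_form fam h T i Y - edge_form fam h T i 0 < 0.
Proof.
move=> h0 Y0; apply: contrapT => /forallNP sl.
have {}sl (i : 'I_(nloc fam)) :
    0 <= edge_form fam h T i Y - edge_form fam h T i 0.
  by rewrite leNgt; apply/negP; exact: sl.
move/eqP: Y0; apply.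
rewrite (ref_coordK h T Y h0) (ref_coordK h T 0 h0).
suff -> : ref_coord h T Y = ref_coord h T 0 by [].
have := sl 0; have := sl 1; have := sl 2%:R.
have : is_rect fam -> 0 <= edge_form fam h T 3 Y - edge_form fam h T 3 0.
  by case: fam sl => // /(_ 3%:R).
rewrite /edge_form; case: (ref_coord h T Y) => x y; case: (ref_coord h T 0) => x' y'.
case: fam {sl} => /=.
1,2: by move=> _ *; congr (_, _); lra.
all: by move=> /(_ isT) *; congr (_, _); lra.
Qed.

Lemma edge_form_opposite fam h T (i : nat) : h != 0 -> (i < nloc fam)%N ->
  exists j, edge_form fam h T i (@vertex R fam h T j) = 1.
Proof.
move=> h0 li.
have jP (j : 'I_(nloc fam)) : edge_form fam h T i (vertex h T j) = 1 ->
  exists j, edge_form fam h T i (@vertex R fam h T j) = 1 by exists j.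
case: fam li jP => /=; case: i => [|[|[|[|//]]]] // _ jP.
all: first
  [ by apply: (jP 0); rewrite /edge_form ref_coord_vertex //=; ring
  | by apply: (jP 1); rewrite /edge_form ref_coord_vertex //=; ring
  | by apply: (jP 2%:R); rewrite /edge_form ref_coord_vertex //=; ring
  | by apply: (jP 3%:R); rewrite /edge_form ref_coord_vertex //=; ring].
Qed.

(** Moving slightly away from a vertex where the form is 1 stays in [T]; by affinity this would make
    the form negative if it vanished at [X]. *)
Lemma interior_edge_form_gt0 fam h T X i : h != 0 ->
  interior (elt_set fam h T) X -> (i < nloc fam)%N -> 0 < edge_form fam h T i X.
Proof.
move=> h0 intX li.
have [j fj] := edge_form_opposite fam h T i h0 li.
have nearX : \forall s \near 0^'+, elt_set fam h T (X + s *: (X - vertex h T j)).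
  have : (fun s : R => X + s *: (X - vertex h T j)) @ 0^'+ --> X.
    have := continuous_line X (X - vertex h T j) 0.
    by move/cvg_at_right_filter; rewrite scale0r addr0.
  by move=> cX; exact: (cX _ intX).
have [s [/(elt_setP _ _ _ _ h0) /(_ (Ordinal li)) /= fs s0]] :
    exists s, elt_set fam h T (X + s *: (X - vertex h T j)) /\ 0 < s.
  have s_gt0 : \forall s \near (0 : R)^'+, 0 < s by exact: nbhs_right_gt.
  by have [s] := filter_ex (filterI nearX s_gt0); exists s.
move: fs; have [c [u1 [u2 fE]]] := edge_form_linear fam h T i.
have -> : edge_form fam h T i (X + s *: (X - vertex h T j)) =
    (1 + s) * edge_form fam h T i X - s * edge_form fam h T i (vertex h T j).
  by rewrite !fE /= -![_ *: _]/(_ * _); ring.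
rewrite fj mulr1 subr_ge0 => /(lt_le_trans s0).
by rewrite pmulr_rgt0 // addr_gt0.
Qed.

(** The ray leaves through the edge whose form vanishes first: [k] minimises the exit time [ex]
    among the forms that decrease along [Y]. *)
Lemma elt_exit fam h T X Y : h != 0 -> Y != 0 ->
  (forall i : 'I_(nloc fam), 0 < edge_form fam h T i X) ->
  exists (k : 'I_(nloc fam)) (r : R), [/\ 0 < r,
    edge_form fam h T k Y - edge_form fam h T k 0 < 0,
    edge_form fam h T k (X + r *: Y) = 0 &
    forall s, 0 <= s <= r -> elt_set fam h T (X + s *: Y)].
Proof.
move=> h0 Y0 X_gt0; have [k0 k0s] := edge_form_slope fam h T Y h0 Y0.
pose sl (i : 'I_(nloc fam)) := edge_form fam h T i Y - edge_form fam h T i 0.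
pose ex (i : 'I_(nloc fam)) := edge_form fam h T i X / - sl i.
have : exists2 k, sl k < 0 & forall i, sl i < 0 -> ex k <= ex i.
  have [|k sk kmin] := @Order.TotalTheory.arg_minP _ _ _ k0 (fun i => sl i < 0) ex.
    exact: k0s.
  by exists k.
move=> [k sk kmin]; exists k, (ex k); split => //.
- by rewrite divr_gt0 ?oppr_gt0.
- rewrite edge_form_shift -/(sl k) /ex invrN mulrN mulNr divfK ?subrr //.
  exact: ltr0_neq0.
- move=> s /andP[s0 sr]; apply/elt_setP => // i; rewrite edge_form_shift -/(sl i).
  have [si|si] := ltP (sl i) 0; last first.
    by rewrite addr_ge0 ?mulr_ge0 // ltW.
  have : s <= ex i by apply: le_trans sr (kmin _ si).
  by rewrite /ex ler_pdivlMr ?oppr_gt0 // mulrN -subr_ge0 opprK.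
Qed.
End Segments.

(** * The sides of the interface *)

Section Adjacency.
Context {R : realType}.
Implicit Types (T : R * R * bool * bool) (h : R) (fam : fe_family).

Lemma ordS_opposite fam (i j : 'I_(nloc fam)) : i != j ->
  ~ (ordS i = j \/ ordS j = i) -> is_rect fam /\ ordS (ordS i) = j.
Proof.
by case: fam i j => -[[|[|[|[|//]]]] li] [[|[|[|[|//]]]] lj] //= ij nonadj;
  first [ by case: nonadj; left; apply/val_inj
        | by case: nonadj; right; apply/val_inj
        | by split=> //; apply/val_inj ].
Qed.

Lemma ordS4 fam (i : 'I_(nloc fam)) : is_rect fam ->
  ordS (ordS (ordS (ordS i))) = i.
Proof. by case: fam i => // -[[|[|[|[|//]]]] li] _; apply/val_inj. Qed.

Lemma vertex_parallelogram fam h T (i : 'I_(nloc fam)) : is_rect fam ->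
  vertex h T i + vertex h T (ordS (ordS i)) =
  vertex h T (ordS i) + vertex h T (ordS (ordS (ordS i))).
Proof.
case: T => [[[p1 p2] sx] sy].
by case: fam i => // -[[|[|[|[|//]]]] li] _; congr (_, _); rewrite /=; ring.
Qed.

Lemma orthonormal_decomp (t n V : R * R) : dot t t = 1 -> dot n n = 1 -> dot t n = 0 ->
  V = dot t V *: t + dot n V *: n.
Proof.
case: t n V => [a b] [c d] [x y]; rewrite /dot /= => ab cd abcd.
(* [e] is the determinant of the frame, equal to 1 or -1, and n is [e] times t turned by a right
   angle. *)
pose e := a * d - b * c.
have cE : c = - e * b.
  transitivity (c * (a * a + b * b) - a * (a * c + b * d)); last by rewrite /e; ring.
  by rewrite ab abcd; ring.
have dE : d = e * a.
  transitivity (d * (a * a + b * b) - b * (a * c + b * d)); last by rewrite /e; ring.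
  by rewrite ab abcd; ring.
have e2 : e * e = 1.
  transitivity (e * e * (a * a + b * b)); first by rewrite ab mulr1.
  by rewrite -cd cE dE; ring.
clearbody e; subst c d; congr (_, _); rewrite /= -![_ *: _]/(_ * _).
- transitivity (x * (a * a + (e * e) * (b * b)) + (1 - e * e) * (a * b * y)).
    by rewrite e2 mul1r ab; ring.
  by ring.
- transitivity (y * ((e * e) * (a * a) + b * b) + (1 - e * e) * (a * b * x)).
    by rewrite e2 mul1r ab; ring.
  by ring.
Qed.
End Adjacency.

Section Interface.
Context {R : realType}.
Variables (fam : fe_family) (h : R) (T : R * R * bool * bool).
(** [A] and [B] stand for the two subdomains in either order, so that one argument, with [n] and [w]
    replaced by their opposites, serves both sides of the line. *)
Variables (Gamma A B : set (R * R)) (D E t n : R * R) (L : R) (w : R -> R).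
Hypothesis h0 : h != 0.
Hypothesis sepAB : separated A B.
Hypothesis sideT : forall X, elt_set fam h T X -> ~ Gamma X -> A X \/ B X.
Hypothesis cutDE : cuts_at fam h Gamma T D E.
Hypotheses (tt : dot t t = 1) (nn : dot n n = 1) (tn : dot t n = 0).
Hypotheses (L0 : 0 < L) (EE : E = D + L *: t).
Hypothesis GammaT :
  Gamma `&` elt_set fam h T = [set D + s *: t + w s *: n | s in `[0, L]].

Lemma edge_boundary (i : 'I_(nloc fam)) X : edge h T i X -> elt_boundary fam h T X.
Proof. by exists i. Qed.

Lemma boundary_elt X : elt_boundary fam h T X -> elt_set fam h T X.
Proof. by move=> [i] /(edgeP _ _ _ _ _ h0)[]. Qed.

Lemma cut_boundary X : elt_boundary fam h T X -> Gamma X -> X = D \/ X = E.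
Proof.
move: cutDE => [_ +] bX gX; rewrite predeqE => /(_ X)[+ _].
by apply.
Qed.

Lemma cut_D : Gamma D /\ elt_boundary fam h T D.
Proof. by move: cutDE => [_]; rewrite predeqE => /(_ D)[_]; apply; left. Qed.

Lemma cut_E : Gamma E /\ elt_boundary fam h T E.
Proof. by move: cutDE => [_]; rewrite predeqE => /(_ E)[_]; apply; right. Qed.

Lemma frame_coord s u X : X = D + s *: t + u *: n ->
  dot t (X - D) = s /\ dot n (X - D) = u.
Proof.
move=> ->; have nt : dot n t = 0 by rewrite dotC.
by split; rewrite addrAC [D + _]addrC addrK dotDr !dotZr ?tt ?tn ?nn ?nt;
  rewrite mulr0 mulr1 ?addr0 ?add0r.
Qed.

Lemma graph_at X : Gamma X -> elt_set fam h T X ->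
  let s := dot t (X - D) in 0 <= s <= L /\ X = D + s *: t + w s *: n.
Proof.
move=> gX TX; have : (Gamma `&` elt_set fam h T) X by [].
rewrite GammaT => -[s /= s01 sX].
have [-> _] := frame_coord _ _ _ (esym sX).
by rewrite sX; split => //; rewrite in_itv in s01.
Qed.

Lemma graph_endpoints : w 0 = 0 /\ w L = 0.
Proof.
have [gD /boundary_elt TD] := cut_D; have [gE /boundary_elt TE] := cut_E.
have [_ /frame_coord[]] := graph_at _ gD TD; rewrite subrr.
have [_ /frame_coord[]] := graph_at _ gE TE; rewrite EE addrC addKr.
rewrite !dotZr tt mulr1 dotC tn mulr0 => _ <-.
by rewrite /dot /= !mulr0 addr0 => _ <-.
Qed.

(** [Gamma] meets the boundary of [T] only at D and E, both of level zero. *)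
Lemma pos_boundary_side X : elt_boundary fam h T X -> 0 < dot n (X - D) ->
  A X \/ B X.
Proof.
move=> bX Xn; apply: sideT; first exact: boundary_elt.
move=> gX; have [] := cut_boundary _ bX gX => XE; move: Xn.
  by rewrite XE subrr /dot /= !mulr0 addr0 ltxx.
by rewrite XE EE addrC addKr dotZr dotC tn mulr0 ltxx.
Qed.

Lemma normal_affine X Y (s : R) : dot n (X + s *: (Y - X) - D) =
  (1 - s) * dot n (X - D) + s * dot n (Y - D).
Proof. by rewrite !dotDr dotZr !dotDr !dotNr; ring. Qed.

(** The level is affine, hence positive between [X] and [Y]; the segment avoids [Gamma] and cannot
    change side. *)
Lemma edge_same_side (i : 'I_(nloc fam)) X Y :
  edge h T i X -> edge h T i Y -> 0 < dot n (X - D) -> 0 < dot n (Y - D) ->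
  A X -> A Y.
Proof.
move=> eX eY Xn Yn; apply: (separated_segment A B X Y) sepAB _ => s /andP[s0 s1].
have s1' : 0 <= 1 - s by rewrite subr_ge0.
apply: pos_boundary_side.
  apply: (@edge_boundary i); apply/edgeP => //.
  have [TX Xi] := (edgeP _ _ _ _ _ h0).1 eX; have [TY Yi] := (edgeP _ _ _ _ _ h0).1 eY.
  rewrite edge_form_affine Xi Yi !mulr0 addr0; split => //.
  apply/elt_setP => // j; rewrite edge_form_affine.
  by rewrite addr_ge0 ?mulr_ge0 //; [exact: (elt_setP _ _ _ _ h0).1 TX _
    | exact: (elt_setP _ _ _ _ h0).1 TY _].
rewrite normal_affine.
have [->|s_neq0] := eqVneq s 0; first by rewrite subr0 mul1r mul0r addr0.
have s_gt0 : 0 < s by rewrite lt0r s_neq0.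
by rewrite ltr_wpDl ?mulr_gt0 // mulr_ge0 // ltW.
Qed.

Lemma vertex_edge (i : 'I_(nloc fam)) :
  edge h T i (vertex h T i) /\ edge h T i (vertex h T (ordS i)).
Proof.
split; [exists 0 | exists 1]; rewrite /= ?in_itv /= ?lexx ?ler01 //.
  by rewrite scale0r addr0.
by rewrite scale1r addrC subrK.
Qed.

Lemma pos_edge_vertex (i : 'I_(nloc fam)) X : edge h T i X -> 0 < dot n (X - D) ->
  exists2 j : 'I_(nloc fam), edge h T i (vertex h T j) & 0 < dot n (vertex h T j - D).
Proof.
move=> [s /= + <-]; rewrite in_itv /= normal_affine => /andP[s0 s1] Xn.
have [vi vSi] := vertex_edge i.
have [Pi|Pi] := ltP 0 (dot n (vertex h T i - D)); first by exists i.
exists (ordS i) => //; rewrite ltNge; apply/negP => PSi.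
move: Xn; rewrite ltNge => /negP; apply.
have s1' : 0 <= 1 - s by rewrite subr_ge0.
by rewrite -oppr_ge0 opprD -!mulrN addr_ge0 ?mulr_ge0 ?oppr_ge0.
Qed.

(** Adjacent vertices share an edge. For opposite vertices of a rectangle the parallelogram law
    gives one of the other two a positive level, and the path goes through it. *)
Lemma pos_vertex_same_side (i j : 'I_(nloc fam)) :
  0 < dot n (vertex h T i - D) -> 0 < dot n (vertex h T j - D) ->
  A (vertex h T i) -> A (vertex h T j).
Proof.
have step (k l : 'I_(nloc fam)) : ordS k = l \/ ordS l = k ->
    0 < dot n (vertex h T k - D) -> 0 < dot n (vertex h T l - D) ->
    A (vertex h T k) -> A (vertex h T l).
  move=> kl Pk Pl.
  have [ek eSk] := vertex_edge k; have [el eSl] := vertex_edge l.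
  case: kl => kl; first by apply: (@edge_same_side k); rewrite // -kl.
  by apply: (@edge_same_side l); rewrite // -kl.
have [|nonadj] := pselect (ordS i = j \/ ordS j = i); first by move/step; apply.
have [->//|ij] := eqVneq i j.
have [rect jE] := ordS_opposite _ i j ij nonadj; subst j.
have par : dot n (vertex h T i - D) + dot n (vertex h T (ordS (ordS i)) - D) =
    dot n (vertex h T (ordS i) - D) + dot n (vertex h T (ordS (ordS (ordS i))) - D).
  have := congr1 (dot n) (vertex_parallelogram fam h T i rect).
  by rewrite !dotDr => ?; lra.
move=> Pi Pj.
have [Pk|Pk] := ltP 0 (dot n (vertex h T (ordS i) - D)).
  move=> Ai; apply: (step (ordS i)) => //; first by left.
  by apply: (step i) => //; left.
have Pl : 0 < dot n (vertex h T (ordS (ordS (ordS i))) - D).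
  by rewrite -(ltrD2l (dot n (vertex h T (ordS i) - D))) -par addr0
    (le_lt_trans Pk) // addr_gt0.
have cyc : ordS (ordS (ordS (ordS i))) = i by exact: ordS4.
move=> Ai; apply: (step (ordS (ordS (ordS i)))) => //; first by right.
by apply: (step i) => //; right.
Qed.

(* The normal line through an interior point of the interface meets the boundary on
   the side of [A]; from there one walks along the edges. *)
Lemma pos_boundary_in X0 X : (forall i : 'I_(nloc fam), 0 < edge_form fam h T i X0) ->
  Gamma X0 -> (\forall s \near 0^'+, A (X0 + s *: n)) ->
  elt_boundary fam h T X -> 0 < dot n (X - D) -> A X.
Proof.
move=> X0_gt0 gX0 nearA [i eX] Xn.
have n0 : n != 0.
  by apply/eqP => nE; move: nn; rewrite nE /dot /= mulr0 addr0 => /esym/eqP; rewrite oner_eq0.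
have TX0 : elt_set fam h T X0 by apply/elt_setP => // j; exact/ltW.
have [/andP[s0 sL] X0E] := graph_at X0 gX0 TX0.
set s := dot t (X0 - D) in s0 sL X0E.
have notbd Y : elt_boundary fam h T Y -> X0 <> Y.
  move=> [j /(edgeP _ _ _ _ _ h0)[_ fj]] YE.
  by have := X0_gt0 j; rewrite YE fj ltxx.
have [w0 wL] := graph_endpoints.
have s_gt0 : 0 < s.
  rewrite lt_def s0 andbT; apply/eqP => sE; apply: (notbd D); first by have [] := cut_D.
  by rewrite X0E sE w0 !scale0r !addr0.
have s_ltL : s < L.
  rewrite lt_def sL andbT; apply/eqP => sE; apply: (notbd E); first by have [] := cut_E.
  by rewrite X0E -sE wL scale0r addr0 EE.
have [k [r [r0 slk fk Tr]]] := elt_exit fam h T X0 n h0 n0 X0_gt0.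
pose Z := X0 + r *: n.
have TZ : elt_set fam h T Z by apply: Tr; rewrite lexx ltW.
have eZ : edge h T k Z by apply/edgeP.
(* In [T] the interface is a graph over the first axis, so the ray along [n] meets it only at
   [X0]. *)
have offGamma (u : R) : 0 < u -> u <= r -> A (X0 + u *: n) \/ B (X0 + u *: n).
  move=> u0 ur; have TU : elt_set fam h T (X0 + u *: n) by apply: Tr; rewrite ur ltW.
  apply: sideT => // gU; have [_ /frame_coord[st sn]] := graph_at _ gU TU.
  have [_ wX0] := frame_coord _ _ _ X0E.
  have cD : X0 + u *: n - D = (X0 - D) + u *: n by rewrite addrAC.
  move: sn; rewrite cD (dotDr n (X0 - D)) (dotDr t (X0 - D)) !dotZr nn mulr1 tn mulr0.
  rewrite addr0 -/s wX0 => /eqP.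
  by rewrite -subr_eq0 addrAC subrr add0r gt_eqF.
have AZ : A Z.
  have rnear : \forall u \near (0 : R)^'+, u < r by exact: nbhs_right_lt.
  have u0near : \forall u \near (0 : R)^'+, 0 < u by exact: nbhs_right_gt.
  have [u [[Au ur] u0]] := filter_ex (filterI (filterI nearA rnear) u0near).
  apply: (separated_segment A B (X0 + u *: n)) => // v /andP[v0 v1].
  have -> : X0 + u *: n + v *: (Z - (X0 + u *: n)) = X0 + (u + v * (r - u)) *: n.
    rewrite /Z opprD addrACA subrr add0r -scalerBl scalerA -addrA -scalerDl.
    by congr (_ + _ *: _); ring.
  have vr : 0 <= v * (r - u) by rewrite mulr_ge0 // subr_ge0 ltW.
  apply: offGamma; first by rewrite ltr_wpDr.
  rewrite -lerBrDl -[leRHS]mul1r ler_wpM2r // subr_ge0 ltW //.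
(* Otherwise the exit form [f], which decreases along [n], would be nonpositive at the foot of [Z],
   strictly between D and E where [f >= 0]. Then DE lies on the line [f = 0], [f] is a negative
   multiple of the level, and [X], of positive level, falls outside [T]. *)
have Zn : 0 < dot n (Z - D).
  rewrite ltNge; apply/negP => Zn.
  pose f := edge_form fam h T k.
  pose sl_t := f t - f 0; pose sl_n := f n - f 0.
  have fE (x y : R) : f (D + x *: t + y *: n) = f D + x * sl_t + y * sl_n.
    by rewrite /f !edge_form_shift.
  have fD : 0 <= f D by apply: (elt_setP _ _ _ _ h0).1; apply: boundary_elt; case: cut_D.
  have fEnd : 0 <= f D + L * sl_t.
    rewrite /f -edge_form_shift -EE.
    apply: (elt_setP _ _ _ _ h0).1. apply: boundary_elt. by case: cut_E.
  have ZE : Z = D + s *: t + (w s + r) *: n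
    by rewrite /Z {1}X0E (scalerDl n (w s) r) addrA.
  have [_ Zw] := frame_coord _ _ _ ZE.
  have fZ : f D + s * sl_t + (w s + r) * sl_n = 0 by rewrite -fE -ZE.
  have zn_ge0 : 0 <= (w s + r) * sl_n.
    by rewrite -Zw -mulrNN mulr_ge0 ?oppr_ge0 // ltW.
  have conv : (L - s) * f D + s * (f D + L * sl_t) = - L * ((w s + r) * sl_n).
    by rewrite -[(w s + r) * sl_n](addKr (f D + s * sl_t)) fZ; ring.
  have fD0 : f D = 0.
    have : (L - s) * f D <= 0.
      rewrite -(lerD2r (s * (f D + L * sl_t))) conv add0r mulNr.
      by rewrite (le_trans _ (mulr_ge0 s0 fEnd)) // oppr_le0 mulr_ge0 // ltW.
    rewrite pmulr_rle0 ?subr_gt0 // => fD'; apply/eqP; by rewrite eq_le fD' fD.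
  have sl_t0 : sl_t = 0.
    have lt_t : 0 <= sl_t by move: fEnd; rewrite fD0 add0r pmulr_rge0.
    apply/eqP; rewrite eq_le lt_t andbT -(pmulr_rle0 _ s_gt0).
    by move: zn_ge0 fZ; rewrite fD0 => *; lra.
  have TX : elt_set fam h T X by apply: boundary_elt; exists i.
  have := (elt_setP _ _ _ _ h0).1 TX k; rewrite -/(f X).
  have -> : X = D + dot t (X - D) *: t + dot n (X - D) *: n.
    by rewrite -addrA -(orthonormal_decomp _ _ _ tt nn tn) addrC subrK.
  rewrite fE fD0 sl_t0 mulr0 !add0r leNgt => /negP; apply.
  by rewrite pmulr_rlt0.
have [j ej jn] := pos_edge_vertex _ _ eZ Zn; have [l el ln] := pos_edge_vertex _ _ eX Xn.
apply: (edge_same_side _ _ _ el eX) => //.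
apply: (pos_vertex_same_side j) => //.
exact: (edge_same_side _ _ _ eZ ej).
Qed.

End Interface.

(** * Slope of the interface *)

Section Slope.
Context {R : realType}.
Implicit Types (f w : R -> R).

Lemma lipschitz_of_derive f (df : R -> R) (M a b x y : R) :
  (forall z : R, is_derive z 1 f (df z)) ->
  (forall z, a <= z <= b -> `|df z| <= M) ->
  a <= x <= b -> a <= y <= b -> `|f x - f y| <= M * `|x - y|.
Proof.
move=> fD dfM; wlog xy : x y / x <= y.
  move=> H; have [xy|/ltW yx] := leP x y; first exact: H.
  by move=> xab yab; rewrite distrC [`|x - y|]distrC; exact: H.
move=> /andP[ax xb] /andP[ay yb].
have [->|nxy] := eqVneq x y; first by rewrite !subrr normr0 mulr0.
have x_lt_y : x < y by rewrite lt_neqAle nxy.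
have [|c cxy fE] := MVT x_lt_y (fun z _ => fD z).
  by apply: derivable_within_continuous => z _; exact: ex_derive.
rewrite distrC fE normrM [`|x - y|]distrC ler_wpM2r // dfM //.
move: cxy; rewrite in_itv /= => /andP[xc cy].
by rewrite (le_trans ax (ltW xc)) (le_trans (ltW cy) yb).
Qed.

Lemma is_derive_derive1 f (x : R) : derivable f x 1 -> is_derive x 1 f (derive1 f x).
Proof. by move=> fx; rewrite derive1E; exact: derivableP. Qed.

Lemma sqrt_cubed (g : R) : 0 <= g -> Num.sqrt g ^+ 3 = g `^ (3 / 2).
Proof.
by move=> g0; rewrite -powR12_sqrt // -powR_mulrn ?powR_ge0 // -powRrM mulrC.
Qed.

(* [w' / sqrt (1 + w'^2)] is the sine of the angle between the graph and the first
   axis; its derivative is the signed curvature. *)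
Lemma is_derive_sine w (x : R) : C2 w ->
  is_derive x 1 (fun z => derive1 w z / Num.sqrt (1 + derive1 w z ^+ 2))
    (derive1 (derive1 w) x / (1 + derive1 w x ^+ 2) `^ (3 / 2)).
Proof.
move=> [wd _]; have [_ w'd] := wd x.
have dw := is_derive_derive1 _ _ w'd.
pose g z := 1 + derive1 w z ^+ 2.
have g0 z : 0 < g z by rewrite ltr_pwDl // sqr_ge0.
set d2 := derive1 (derive1 w) x in dw *.
have dg : is_derive x 1 g (2 * derive1 w x * d2).
  have -> : g = cst 1 + derive1 w ^+ 2 by apply/funext => z.
  apply: (is_derive_eq (is_deriveD (is_derive_cst (1:R) x 1) (is_deriveX 2 dw))).
  by rewrite add0r expr1 -![_ *: _]/(_ * _).
have ds : is_derive x 1 (fun z => Num.sqrt (g z))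
    ((2 * Num.sqrt (g x))^-1 * (2 * derive1 w x * d2)).
  exact: (@is_derive1_comp _ Num.sqrt g x _ _ (is_derive1_sqrt (g0 x)) dg).
have s0 : Num.sqrt (g x) != 0 by rewrite gt_eqF // sqrtr_gt0.
have dV := @is_deriveV _ (fun z => Num.sqrt (g z)) _ _ _ s0 ds.
have -> : (fun z => derive1 w z / Num.sqrt (1 + derive1 w z ^+ 2)) =
    derive1 w * (fun z => (Num.sqrt (g z))^-1) by apply/funext => z.
apply: (is_derive_eq (is_deriveM dw dV)).
rewrite -/(g x) -sqrt_cubed ?ltW // -![_ *: _]/(_ * _).
have := sqr_sqrtr (ltW (g0 x)); rewrite /g; move: s0.
rewrite -/(g x); move: (Num.sqrt (g x)) => s s0 sE.
transitivity (d2 * (s ^+ 2 - derive1 w x ^+ 2) / s ^+ 3).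
  by field.
by rewrite sE addrK mulr1.
Qed.

Lemma slope_bound w (L kappa : R) : 0 < L -> C2 w -> w 0 = 0 -> w L = 0 ->
  (forall s, 0 <= s <= L -> `|derive1 (derive1 w) s| /
     (1 + derive1 w s ^+ 2) `^ (3 / 2) <= kappa) ->
  forall s, 0 <= s <= L ->
    `|derive1 w s| / Num.sqrt (1 + derive1 w s ^+ 2) <= kappa * L.
Proof.
move=> L0 wC2 w0 wL curv s s0L; have [wd _] := wC2.
have dw z : derivable w z 1 by have [] := wd z.
have [|c cL] := Rolle L0 (fun z _ => dw z) _ (etrans w0 (esym wL)).
  by apply: derivable_within_continuous => z _.
move=> dc; have := @derive_val _ _ _ _ _ _ _ dc; rewrite -derive1E => w'c.
have cL' : 0 <= c <= L by move: cL; rewrite in_itv /= => /andP[/ltW -> /ltW ->].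
have := @lipschitz_of_derive _ _ kappa 0 L s c
  (fun z => is_derive_sine w z wC2) _ s0L cL'.
rewrite w'c mul0r subr0 normrM normfV (ger0_norm (sqrtr_ge0 _)) => H.
have k0 : 0 <= kappa.
  apply: le_trans (curv s s0L); by rewrite divr_ge0 // powR_ge0.
apply: le_trans (H _) _.
  move=> z zL; rewrite normrM normfV (ger0_norm (powR_ge0 _ _)); exact: curv.
rewrite ler_wpM2l //; move: s0L cL' => /andP[? ?] /andP[? ?].
by rewrite ler_norml; apply/andP; split; lra.
Qed.

(** A sine of at most q/2 <= 1/2 has a cosine of at least sqrt 3 / 2, hence a tangent of at most q /
    sqrt 3. *)
Lemma slope_le w (s q : R) : 0 <= q <= 1 ->
  `|derive1 w s| / Num.sqrt (1 + derive1 w s ^+ 2) <= q / 2 -> `|derive1 w s| <= q.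
Proof.
move=> /andP[q0 q1]; set d := derive1 w s.
have g0 : 0 < 1 + d ^+ 2 by rewrite ltr_pwDl // sqr_ge0.
rewrite ler_pdivrMr ?sqrtr_gt0 // => dq.
have : d ^+ 2 <= (q / 2) ^+ 2 * (1 + d ^+ 2).
  rewrite -(sqr_sqrtr (ltW g0)) -exprMn -(real_normK (num_real d)).
  by rewrite lerXn2r ?nnegrE ?mulr_ge0 ?sqrtr_ge0 ?divr_ge0 // real_normK ?num_real.
move=> H; rewrite -(ler_sqr (normr_ge0 _) q0) // (real_normK (num_real d)).
have : q ^+ 2 * d ^+ 2 <= d ^+ 2.
  by rewrite ler_piMl ?sqr_ge0 // exprn_ile1.
have qE : (q / 2) ^+ 2 * (1 + d ^+ 2) = (q ^+ 2 + q ^+ 2 * d ^+ 2) / 4 by field.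
have := sqr_ge0 q; move: H; rewrite qE => ? ? ?; lra.
Qed.

Lemma frame_sub (D t n : R * R) (x y x' y' : R) :
  D + x *: t + y *: n - (D + x' *: t + y' *: n) = (x - x') *: t + (y - y') *: n.
Proof.
by case: D t n => [? ?] [? ?] [? ?]; congr (_, _);
  rewrite /= -![_ *: _]/(_ * _); ring.
Qed.

(** The tangent (1, w'(s)) is orthogonal to the normal. Along a secant with difference quotient
    [q h], the estimate in [unit_normal] bounds [a + b * q h], and [q h] tends to w'(s); a nonzero
    [A] would satisfy |A| <= |A|/4 + |A|/4. *)
Lemma unit_normal_graph (C : set (R * R)) (D t n F nF : R * R) (L s : R) w :
  dot t t = 1 -> dot n n = 1 -> dot t n = 0 ->
  0 < L -> derivable w s 1 -> C = [set D + s *: t + w s *: n | s in `[0, L]] ->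
  0 <= s <= L -> F = D + s *: t + w s *: n -> unit_normal C F nF ->
  dot nF t + derive1 w s * dot nF n = 0.
Proof.
move=> tt nn tn L0 wd CE /andP[s0 sL] FE [_ nF_small].
set a := dot nF t; set b := dot nF n; set d := derive1 w s; pose A := a + d * b.
apply/eqP/negP => /negP A0.
have A_gt0 : 0 < `|A| by rewrite normr_gt0.
(* [e] and [e1] are chosen so that e (2 + |d|) and e1 (1 + |b|) both equal |A|/4. *)
pose e := `|A| / 4 / (2 + `|d|).
have d2 : 0 < 2 + `|d| by rewrite ltr_pwDl.
have e0 : 0 < e by rewrite !divr_gt0.
pose e1 := `|A| / 4 / (1 + `|b|).
have b1 : 0 < 1 + `|b| by rewrite ltr_pwDl.
have e10 : 0 < e1 by rewrite !divr_gt0.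
pose gam u := D + u *: t + w u *: n.
have gam_cont : {for s, continuous gam}.
  rewrite /gam; apply: cvgD.
    by apply: cvgD; [exact: cvg_cst | apply: cvgZr_tmp; exact: cvg_id].
  apply: cvgZr_tmp; apply: differentiable_continuous; exact/derivable1_diffP.
have [r1 r10 near1] : exists2 r, 0 < r & forall h, `|h| < r ->
    C (gam (s + h)) -> `|dot nF (gam (s + h) - F)| <= e * enorm (gam (s + h) - F).
  have : \forall Y \near gam s, C Y -> `|dot nF (Y - F)| <= e * enorm (Y - F).
    by rewrite /gam -FE; exact: nF_small.
  move/gam_cont => /nbhs_ballP[r /= r0 rH]; exists r => // h hr Ch.
  by apply: rH Ch; rewrite /ball /= opprD addNKr normrN.
pose q h := h^-1 * (w (s + h) - w s).
have [r2 r20 near2] : exists2 r, 0 < r & forall h, `|h| < r -> h != 0 ->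
    `|q h - d| <= Num.min 1 e1.
  have : (fun h : R => h^-1 *: (w (h *: 1 + s) - w s)) @ 0^' --> d.
    by rewrite /d derive1E; exact: wd.
  have m0 : 0 < Num.min 1 e1 by rewrite lt_min ltr01.
  move=> /cvgrPdist_le/(_ _ m0)/nbhs_ballP[r /= r0 rH]; exists r => // h hr h0.
  have := rH h; rewrite /ball /= sub0r normrN => /(_ hr h0).
  by rewrite distrC /q [s + h]addrC -![_ *: _]/(_ * _) mulr1.
pose r := Num.min (Num.min r1 r2) (L / 2) / 2.
have r0 : 0 < r by rewrite divr_gt0 // !lt_min r10 r20 divr_gt0.
have [rr1 rr2 rL] : [/\ r < r1, r < r2 & r < L / 2].
  have H x : 0 < x -> Num.min (Num.min r1 r2) (L / 2) <= x -> r < x.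
    move=> x0 xH; rewrite /r ltr_pdivrMr // (le_lt_trans xH) //; lra.
  by split; apply: H; rewrite ?divr_gt0 // !ge_min lexx ?orbT.
(* At an endpoint of the arc only one sign of the increment is available, so it points towards the
   farther endpoint. *)
have [h hr hL] : exists2 h, `|h| = r & 0 <= s + h <= L.
  have [sL2|sL2] := leP s (L / 2).
    exists r; first by rewrite gtr0_norm.
    by apply/andP; split; lra.
  exists (- r); first by rewrite normrN gtr0_norm.
  by apply/andP; split; lra.
have h0 : h != 0 by rewrite -normr_gt0 hr.
have gamE : gam (s + h) - F = h *: t + (h * q h) *: n.
  by rewrite /q mulVKf // FE /gam frame_sub addrAC subrr add0r.
have Ch : C (gam (s + h)) by rewrite CE; exists (s + h).
clearbody q; have := near1 h; rewrite hr => /(_ rr1 Ch).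
have -> : dot nF (gam (s + h) - F) = h * (a + b * q h).
  by rewrite gamE dotDr !dotZr -/a -/b; ring.
have -> : enorm (gam (s + h) - F) = `|h| * Num.sqrt (1 + q h ^+ 2).
  rewrite /enorm -sqrtr_sqr -sqrtrM ?sqr_ge0 // gamE; congr (Num.sqrt _).
  transitivity (h ^+ 2 * dot t t + 2 * h ^+ 2 * q h * dot t n + (h * q h) ^+ 2 * dot n n).
    by rewrite /dot /= -![_ *: _]/(_ * _); ring.
  by rewrite tt nn tn; ring.
rewrite normrM [e * _]mulrCA ler_pM2l ?hr // => H1.
have := near2 h; rewrite hr => /(_ rr2 h0); rewrite le_min => /andP[q1 qe1].
have H2 : Num.sqrt (1 + q h ^+ 2) <= 2 + `|d|.
  have : `|q h| <= 1 + `|d|.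
    by rewrite -[q h](subrK d) (le_trans (ler_normD _ _)) // lerD2r.
  move=> qd; rewrite -(ler_sqr (sqrtr_ge0 _) (ltW d2)) sqr_sqrtr ?addr_ge0 ?sqr_ge0 //.
  rewrite -(real_normK (num_real (q h))).
  have := normr_ge0 (q h); have := normr_ge0 d => ? ?; nra.
have H3 : `|a + b * q h| <= `|A| / 4.
  apply: (le_trans H1); apply: (le_trans (ler_wpM2l (ltW e0) H2)).
  by rewrite /e divfK // gt_eqF.
have H4 : `|b| * `|q h - d| <= `|A| / 4.
  have : `|b| * `|q h - d| <= (1 + `|b|) * e1.
    by rewrite ler_pM // lerDr.
  by move/le_trans; apply; rewrite /e1 mulrC divfK // gt_eqF.
have : `|A| <= `|a + b * q h| + `|b| * `|q h - d|.
  have -> : A = (a + b * q h) - b * (q h - d) by rewrite /A; ring.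
  by rewrite (le_trans (ler_normB _ _)) // normrM.
by lra.
Qed.

End Slope.

(** * Inequalities on the reference square *)

Section BilinearInequality.
Context {R : realType}.
Implicit Types a b c d e u v x y tau : R.

Definition neg_part u : R := Num.min u 0.

Lemma neg_partP u : (neg_part u = u /\ u <= 0) \/ (neg_part u = 0 /\ 0 <= u).
Proof.
rewrite /neg_part; have [u0|/ltW u0] := leP u 0; [left|right]; split => //.
Qed.

Lemma neg_part_incr u d : 0 <= d -> neg_part u <= neg_part (u + d) <= neg_part u + d.
Proof.
move=> d0; have [[-> ?]|[-> ?]] := neg_partP u;
  have [[-> ?]|[-> ?]] := neg_partP (u + d); by apply/andP; split; lra.
Qed.

Lemma neg_part_mono u v : 0 <= (neg_part v - neg_part u) * (v - u).
Proof.
have incr x y : x <= y -> neg_part x <= neg_part y.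
  move=> xy; have := neg_part_incr x (y - x); rewrite subr_ge0 => /(_ xy)/andP[+ _].
  by have -> : x + (y - x) = y by ring.
have [uv|/ltW vu] := leP u v; first by rewrite mulr_ge0 // subr_ge0 // incr.
by rewrite mulr_le0 // subr_le0 // incr.
Qed.

(** Concavity of min(., 0): increments of equal length shrink as the base point moves right. *)
Lemma neg_part_concave u d e : 0 <= d -> 0 <= e ->
  neg_part (u + d + e) - neg_part (u + e) <= neg_part (u + d) - neg_part u.
Proof.
move=> d0 e0.
have [[-> ?]|[-> ?]] := neg_partP u; have [[-> ?]|[-> ?]] := neg_partP (u + d);
have [[-> ?]|[-> ?]] := neg_partP (u + e);
have [[-> ?]|[-> ?]] := neg_partP (u + d + e); lra.
Qed.

(** Derivative in x, at height [y], of the Q1 interpolant of min(c + a x + b y, 0) on the unit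
    square; [bilin_gx c b a x] is its derivative in y. *)
Definition bilin_gx c a b y : R :=
  (1 - y) * (neg_part (c + a) - neg_part c) +
  y * (neg_part (c + a + b) - neg_part (c + b)).

Definition on_square_boundary x y : Prop :=
  [/\ 0 <= x <= 1, 0 <= y <= 1 & [\/ x = 0, x = 1, y = 0 | y = 1]].

(** (a - tau b, b + tau a) is the normal (a, b) turned by an angle of tangent [tau]. Both gradient
    components are nonnegative, so only a negative a - tau b can do harm. *)
Lemma bilin_core c a b x y dx dy ex ey tau : 0 <= a -> 0 <= b -> 0 <= tau <= 5^-1 ->
  on_square_boundary dx dy -> on_square_boundary ex ey -> (dx, dy) != (ex, ey) ->
  c + a * dx + b * dy = 0 -> c + a * ex + b * ey = 0 ->
  0 <= x <= 1 -> 0 <= y <= 1 -> `|x - (dx + ex) / 2| <= 5^-1 ->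
  0 <= bilin_gx c a b y * (a - tau * b) + bilin_gx c b a x * (b + tau * a).
Proof.
move=> a0 b0 /andP[tau0 tau5] [/andP[dx0 dx1] /andP[dy0 dy1] Dbd]
  [/andP[ex0 ex1] /andP[ey0 ey1] Ebd] DE Dl El /andP[x0 x1] /andP[y0 y1].
rewrite ler_norml => /andP[xl xu].
set gx := bilin_gx c a b y; set gy := bilin_gx c b a x.
have /andP[m21 m21a] := neg_part_incr c a a0.
have /andP[m34 m34a] := neg_part_incr (c + b) a a0.
have /andP[m41 m41a] := neg_part_incr c b b0.
have /andP[m32 m32a] := neg_part_incr (c + a) b b0.
have gxE : gx = (1 - y) * (neg_part (c + a) - neg_part c) +
  y * (neg_part (c + b + a) - neg_part (c + b)) by rewrite /gx /bilin_gx [c + b + a]addrAC.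
have gyE : gy = (1 - x) * (neg_part (c + b) - neg_part c) +
  x * (neg_part (c + a + b) - neg_part (c + a)) by rewrite /gy /bilin_gx [c + a + b]addrAC.
have gx0 : 0 <= gx by rewrite gxE addr_ge0 // mulr_ge0 // subr_ge0.
have gy0 : 0 <= gy by rewrite gyE addr_ge0 // mulr_ge0 // subr_ge0.
have [ab|ab] := leP (tau * b) a.
  by rewrite addr_ge0 ?mulr_ge0 ?subr_ge0 // addr_ge0 // mulr_ge0.
have ba : a <= b / 5 by nra.
have b_gt0 : 0 < b.
  by rewrite lt0r b0 andbT; apply/eqP => bE; move: ab; rewrite bE mulr0 ltNge a0.
have conc := neg_part_concave c b a b0 a0.
have gx_le : gx <= neg_part (c + a) - neg_part c.
  have : y * (neg_part (c + b + a) - neg_part (c + b)) <=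
      y * (neg_part (c + a) - neg_part c) by rewrite ler_wpM2l //; lra.
  by rewrite gxE; lra.
(* The line is nearly horizontal: only the term [- tau * b * gx] is negative, and it is
   dominated by [b * gy], the vertical increments of [neg_part] being large. *)
suff main : tau * gx <= gy.
  have : tau * b * gx <= b * gy by rewrite [tau * b]mulrC -mulrA ler_wpM2l.
  have ? : 0 <= gx * a by rewrite mulr_ge0.
  have ? : 0 <= gy * (tau * a) by rewrite !mulr_ge0.
  by move=> ?; lra.
have tau_gx z : gx <= z -> tau * gx <= z / 5.
  by move=> gxz; rewrite mulrC ler_pM //; exact: le_trans gxz.
(* [x] is within 1/5 of the midpoint of DE, so in [gy] the left column has weight 1 - x >= 3/10 in
   the first case and the right column weight x >= 3/10 in the second; 3/10 beats tau <= 1/5. *)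
have [mid|mid] := leP (dx + ex) 1.
  have m42 : neg_part (c + a) <= neg_part (c + b).
    have ab' : 0 <= b - a by lra.
    have /andP[+ _] := neg_part_incr (c + a) _ ab'.
    by have -> : c + a + (b - a) = c + b by ring.
  apply: (le_trans (tau_gx _ gx_le)).
  have : (3 / 10) * (neg_part (c + b) - neg_part c) <=
      (1 - x) * (neg_part (c + b) - neg_part c) by rewrite ler_wpM2r ?subr_ge0 //; lra.
  have : 0 <= x * (neg_part (c + a + b) - neg_part (c + a)).
    by rewrite mulr_ge0 // subr_ge0.
  by rewrite gyE; lra.
(* Past the middle, the line must enter the square through its top edge. *)
have [aE|a_neq0] := eqVneq a 0.
  move: gx_le; rewrite aE addr0 subrr => gx_le.
  by rewrite (le_trans (tau_gx _ gx_le)) // mul0r.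
have a_gt0 : 0 < a by rewrite lt0r a_neq0.
have adx : a * dx <= a by rewrite ler_piMr.
have bdy : b * dy <= b by rewrite ler_piMr.
(* If the top left corner had positive level, D and E, whose abscissas are positive, would both lie
   on the right or bottom edge; a level increasing in x and y does not vanish at two distinct points
   there. *)
have top : c + b <= 0.
  rewrite leNgt; apply/negP => cb.
  have side dx' dy' : 0 < dx' -> dx' <= 1 -> c + a * dx' + b * dy' = 0 ->
      [\/ dx' = 0, dx' = 1, dy' = 0 | dy' = 1] -> dx' = 1 \/ dy' = 0.
    move=> d0 d1 dl [dE|dE|dE|dE]; [lra|by left|by right|].
    by have := mulr_gt0 a_gt0 d0; move: dl; rewrite dE; lra.
  have eqx : a * dx = a * ex -> dx = ex by exact: mulfI.
  have eqy : b * dy = b * ey -> dy = ey by apply: mulfI; rewrite gt_eqF.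
  have bdy0 : 0 <= b * dy by rewrite mulr_ge0.
  have bey0 : 0 <= b * ey by rewrite mulr_ge0.
  have aex : a * ex <= a by rewrite ler_piMr.
  have dx_gt0 : 0 < dx by lra.
  have ex_gt0 : 0 < ex by lra.
  have := side dx dy dx_gt0 dx1 Dl Dbd; have := side ex ey ex_gt0 ex1 El Ebd.
  move=> Eside Dside.
  have ydy : b * dy = b * ey -> False.
    move=> bE; have aE : a * dx = a * ex by move: Dl El; rewrite bE => *; lra.
    by move/eqP: DE; apply; rewrite (eqx aE) (eqy bE).
  case: Dside => dE; case: Eside => eE.
  - by apply: ydy; move: Dl El; rewrite dE eE => *; lra.
  - by apply: ydy; move: Dl El; rewrite dE eE => *; lra.
  - by apply: ydy; move: Dl El; rewrite dE eE => *; lra.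
  - by apply: ydy; rewrite dE eE.
have u3 : neg_part (c + a + b) = 0.
  by rewrite /neg_part min_r //; lra.
have u2 : neg_part (c + a) = c + a by rewrite /neg_part min_l //; lra.
apply: (le_trans (tau_gx a _)).
  by apply: (le_trans gx_le); lra.
have : (3 / 10) * (b - a) <= x * (neg_part (c + a + b) - neg_part (c + a)).
  by rewrite ler_pM //; lra.
have : 0 <= (1 - x) * (neg_part (c + b) - neg_part c).
  by rewrite mulr_ge0 // subr_ge0.
by rewrite gyE; lra.
Qed.


Lemma bilin_gx_sym c a b y : bilin_gx (c + b) a (- b) (1 - y) = bilin_gx c a b y.
Proof.
by rewrite /bilin_gx [c + b + a]addrAC !addrK; ring.
Qed.

Lemma bilin_gx_opp c a b y : bilin_gx (c + a) (- a) b y = - bilin_gx c a b y.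
Proof. by rewrite /bilin_gx addrK; ring. Qed.

Lemma square_flip x y : on_square_boundary x y -> on_square_boundary (1 - x) y.
Proof.
move=> [/andP[x0 x1] y01 bd]; split => //; first by apply/andP; split; lra.
case: bd => bd; [constructor 2|constructor 1|constructor 3|constructor 4] => //; lra.
Qed.

Lemma square_swap x y : on_square_boundary x y -> on_square_boundary y x.
Proof.
move=> [x01 y01 bd]; split => //.
by case: bd => bd; [constructor 3|constructor 4|constructor 1|constructor 2].
Qed.

(** Symmetries of the square reduce this to [bilin_core]: a reflection changes the signs of [tau]
    and of [a] or [b]; exchanging the axes changes that of [tau]. *)
Lemma bilin_ge0 c a b x y dx dy ex ey tau : `|tau| <= 5^-1 ->
  on_square_boundary dx dy -> on_square_boundary ex ey -> (dx, dy) != (ex, ey) ->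
  c + a * dx + b * dy = 0 -> c + a * ex + b * ey = 0 ->
  0 <= x <= 1 -> 0 <= y <= 1 ->
  `|x - (dx + ex) / 2| <= 5^-1 -> `|y - (dy + ey) / 2| <= 5^-1 ->
  0 <= bilin_gx c a b y * (a - tau * b) + bilin_gx c b a x * (b + tau * a).
Proof.
wlog a0 : c a x dx ex tau / 0 <= a.
  move=> H; have [a0|/ltW a0] := leP 0 a; first exact: H.
  move=> t5 bD bE DE lD lE x01 y01 xm ym.
  have := H (c + a) (- a) (1 - x) (1 - dx) (1 - ex) (- tau).
  rewrite bilin_gx_opp bilin_gx_sym => H'.
  suff : 0 <= - bilin_gx c a b y * (- a - - tau * b) +
      bilin_gx c b a x * (b + - tau * - a).
    by congr (_ <= _); ring.
  apply: H' => //; rewrite ?oppr_ge0 ?normrN //; try exact: square_flip.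
  - apply: contra DE; rewrite !xpair_eqE => /andP[/eqP e ->]; rewrite andbT.
    by apply/eqP; lra.
  - by rewrite -lD; ring.
  - by rewrite -lE; ring.
  - by move: x01 => /andP[? ?]; apply/andP; split; lra.
  - by rewrite -normrN; move: xm; congr (`|_| <= _); field.
wlog b0 : c b y dy ey tau / 0 <= b.
  move=> H; have [b0|/ltW b0] := leP 0 b; first exact: H.
  move=> t5 bD bE DE lD lE x01 y01 xm ym.
  have := H (c + b) (- b) (1 - y) (1 - dy) (1 - ey) (- tau).
  rewrite bilin_gx_opp bilin_gx_sym => H'.
  suff : 0 <= bilin_gx c a b y * (a - - tau * - b) +
      - bilin_gx c b a x * (- b + - tau * a).
    by congr (_ <= _); ring.
  apply: H' => //; rewrite ?oppr_ge0 ?normrN //;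
    try by apply/square_swap/square_flip/square_swap.
  - apply: contra DE; rewrite !xpair_eqE => /andP[-> /eqP e] /=.
    by apply/eqP; lra.
  - by rewrite -lD; ring.
  - by rewrite -lE; ring.
  - by move: y01 => /andP[? ?]; apply/andP; split; lra.
  - by rewrite -normrN; move: ym; congr (`|_| <= _); field.
move=> t5 bD bE DE lD lE x01 y01 xm ym.
have [t0|/ltW t0] := leP 0 tau.
  apply: (@bilin_core c a b x y dx dy ex ey) => //.
  by rewrite t0 -[tau]ger0_norm.
have := @bilin_core c b a y x dy dx ey ex (- tau) b0 a0.
move=> H'.
suff : 0 <= bilin_gx c b a x * (b - - tau * a) + bilin_gx c a b y * (a + - tau * b).
  by congr (_ <= _); ring.
apply: H' => //; try exact: square_swap.
- by rewrite oppr_ge0 t0 -[- tau]ger0_norm ?oppr_ge0 // normrN.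
- by move: DE; rewrite !xpair_eqE andbC.
- by rewrite -lD; ring.
- by rewrite -lE; ring.
Qed.

End BilinearInequality.

(** * The gradient inequality for rotated Q1 *)

Section Rotated.
Context {R : realType}.
Implicit Types a b c d e u v x y tau : R.

(** Derivative in x of the rotated-Q1 interpolant of min(c + a x + b y, 0) on the centred unit
    square, with nodes at the edge midpoints; the second difference is the coefficient of x^2 -
    y^2. *)
Definition rot_gx c a b x : R :=
  neg_part (c + a / 2) - neg_part (c - a / 2) +
  2 * x * (neg_part (c + a / 2) + neg_part (c - a / 2)
           - neg_part (c + b / 2) - neg_part (c - b / 2)).

(** [d] is a difference of values of u |-> min(c + u, 0) + min(c - u, 0), whose slopes for u >= 0
    are -1 or 0. The last expression is the gradient times (a, b) at a point of the line with
    abscissa -1/2, where a x0 - b y0 = c + 2 a x0 takes its least value c - a. *)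
Lemma rot_second_difference c a b : 0 <= a <= b ->
  let d := neg_part (c + a / 2) + neg_part (c - a / 2)
           - neg_part (c + b / 2) - neg_part (c - b / 2) in
  [/\ 0 <= d, d <= (b - a) / 2 &
   0 <= a * (neg_part (c + a / 2) - neg_part (c - a / 2)) +
        b * (neg_part (c + b / 2) - neg_part (c - b / 2)) + 2 * (c - a) * d].
Proof.
move=> /andP[a0 ab] /=.
have ba : 0 <= b - a by rewrite subr_ge0.
(* The nodal levels decrease in the order c + b/2, c + a/2, c - a/2, c - b/2, so the first
   nonpositive one decides all the minima. *)
have [[-> h3]|[-> h3]] := neg_partP (c + b / 2).
  have -> : neg_part (c + a / 2) = c + a / 2 by rewrite /neg_part min_l //; lra.
  have -> : neg_part (c - a / 2) = c - a / 2 by rewrite /neg_part min_l //; lra.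
  have -> : neg_part (c - b / 2) = c - b / 2 by rewrite /neg_part min_l //; lra.
  have -> : c + a / 2 + (c - a / 2) - (c + b / 2) - (c - b / 2) = 0 by ring.
  split; [by []|lra|].
  have -> : a * (c + a / 2 - (c - a / 2)) + b * (c + b / 2 - (c - b / 2)) +
    2 * (c - a) * 0 = a * a + b * b by field.
  by rewrite addr_ge0 // mulr_ge0 //; lra.
have [[-> h2]|[-> h2]] := neg_partP (c + a / 2).
  have -> : neg_part (c - a / 2) = c - a / 2 by rewrite /neg_part min_l //; lra.
  have -> : neg_part (c - b / 2) = c - b / 2 by rewrite /neg_part min_l //; lra.
  split; [lra|lra|].
  (* [v] is minus the level c + a/2; in terms of it the expression is a sum of nonnegative
     products. *)
  pose v := (b - a) / 2 - (c + b / 2).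
  have v0 : 0 <= v by rewrite /v; lra.
  have -> : a * (c + a / 2 - (c - a / 2)) + b * (0 - (c - b / 2)) +
    2 * (c - a) * (c + a / 2 + (c - a / 2) - 0 - (c - b / 2)) =
    2 * (v * v) + 4 * (a * v) + (b - a) * (b - a) / 2 + 2 * (a * a).
    by rewrite /v; field.
  by rewrite !addr_ge0 ?mulr_ge0.
have [[-> h4]|[-> h4]] := neg_partP (c - a / 2).
  have -> : neg_part (c - b / 2) = c - b / 2 by rewrite /neg_part min_l //; lra.
  split; [lra|lra|].
  have -> : a * (0 - (c - a / 2)) + b * (0 - (c - b / 2)) +
    2 * (c - a) * (0 + (c - a / 2) - 0 - (c - b / 2)) =
    (b - a) * (b - a) / 2 + 2 * (a * (a / 2 - c)) by field.
  by rewrite addr_ge0 ?mulr_ge0 //; lra.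
have [[-> h1]|[-> h1]] := neg_partP (c - b / 2).
  split; [lra|lra|].
  have -> : a * (0 - 0) + b * (0 - (c - b / 2)) +
    2 * (c - a) * (0 + 0 - 0 - (c - b / 2)) = (b / 2 - c) * (b + 2 * c - 2 * a) by field.
  by rewrite mulr_ge0 //; lra.
split; [lra|lra|].
by rewrite !subr0 !addr0 !mulr0 !addr0.
Qed.

Lemma rot_core c a b x y x0 y0 w tau r s : 0 <= a <= b -> a * a + b * b = 1 ->
  x = x0 + w * a -> y = y0 + w * b -> c + a * x0 + b * y0 = 0 ->
  - 2^-1 <= x0 -> `|x| <= 2^-1 -> `|y| <= 2^-1 -> `|w| <= r -> `|tau| <= s ->
  - (r + 2 * s) <= rot_gx c a b x * (a - tau * b) + rot_gx c b a y * (b + tau * a).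
Proof.
move=> ab; have [d0 dle foot] := rot_second_difference c a b ab; move: ab => /andP[a0 ab].
move=> ab1 xE yE l0 x0l xb yb ws ts.
have s0 : 0 <= s by apply: le_trans ts.
have ba2 : b - a <= b + a by lra.
have b1 : b <= 1 by nra.
rewrite /rot_gx.
set d := _ - _ - _ in d0 dle foot *.
have -> : neg_part (c + b / 2) + neg_part (c - b / 2) -
  neg_part (c + a / 2) - neg_part (c - a / 2) = - d by rewrite /d; ring.
set p := neg_part (c + a / 2) - neg_part (c - a / 2) in foot *.
set q := neg_part (c + b / 2) - neg_part (c - b / 2) in foot *.
have pb : 0 <= p <= a.
  have /andP[] := neg_part_incr (c - a / 2) a a0.
  have -> : c - a / 2 + a = c + a / 2 by field.
  by rewrite -/p => ? ?; apply/andP; rewrite /p; split; lra.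
have b0 : 0 <= b by lra.
have qb : 0 <= q <= b.
  have /andP[] := neg_part_incr (c - b / 2) b b0.
  have -> : c - b / 2 + b = c + b / 2 by field.
  by rewrite -/q => ? ?; apply/andP; rewrite /q; split; lra.
clearbody d p q.
(* Gradient times normal at the foot (x0, y0), plus the effect of the displacement [w] along the
   normal, plus that of the tilt [tau]; these are bounded below by 0, -r and -2 s. *)
have -> : (p + 2 * x * d) * (a - tau * b) + (q + 2 * y * - d) * (b + tau * a) =
  (a * p + b * q + 2 * (a * x0 - b * y0) * d) + 2 * d * w * (a * a - b * b)
  + tau * (a * (q - 2 * y * d) - b * (p + 2 * x * d)) by rewrite xE yE; ring.
have t1 : 0 <= a * p + b * q + 2 * (a * x0 - b * y0) * d.
  have : 0 <= 2 * (a * (x0 + 2^-1)) * d *+ 2.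
    by rewrite mulrn_wge0 // !mulr_ge0 //; lra.
  have -> : a * x0 - b * y0 = (c - a) + 2 * (a * (x0 + 2^-1)).
    have -> : c = - (a * x0 + b * y0) by lra.
    by field.
  by move: foot; rewrite mulr2n => *; lra.
have t2 : `|2 * d * w * (a * a - b * b)| <= r.
  have dd : `|2 * d * (a * a - b * b)| <= 1.
    rewrite normrM ger0_norm ?mulr_ge0 // distrC ger0_norm; last by nra.
    have : 2 * d * (b * b - a * a) <= (b - a) * (b * b - a * a).
      by apply: ler_wpM2r; nra.
    by nra.
  rewrite -mulrA [w * _]mulrC mulrA normrM -[r]mul1r.
  by rewrite ler_pM.
have t3 : `|a * (q - 2 * y * d) - b * (p + 2 * x * d)| <= 2.
  move: xb yb pb qb; rewrite !ler_norml => /andP[? ?] /andP[? ?] /andP[? ?] /andP[? ?].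
  have dn : `|d| <= (b - a) / 2 by rewrite ger0_norm.
  have zd z : - 2^-1 <= z -> z <= 2^-1 -> `|2 * z * d| <= (b - a) / 2.
    move=> z0 z1; have z2 : `|2 * z| <= 1 by rewrite ler_norml; apply/andP; split; lra.
    by rewrite normrM -[leRHS]mul1r ler_pM.
  have xd : `|2 * x * d| <= (b - a) / 2 by apply: zd.
  have yd : `|2 * y * d| <= (b - a) / 2 by apply: zd.
  move: xd yd; rewrite !ler_norml => /andP[xd1 xd2] /andP[yd1 yd2].
  have a1 : a <= 1 by nra.
  set P := p + 2 * x * d; set Q := q - 2 * y * d.
  have P1 : `|P| <= (a + b) / 2.
    by rewrite ler_norml /P; apply/andP; split; lra.
  have Q1 : `|Q| <= (3 * b - a) / 2.
    by rewrite ler_norml /Q; apply/andP; split; lra.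
  rewrite -ler_norml; apply: (le_trans (ler_normB (a * Q) (b * P))).
  rewrite !normrM (ger0_norm a0) (ger0_norm b0).
  have : a * `|Q| <= a * ((3 * b - a) / 2) by rewrite ler_wpM2l.
  have : b * `|P| <= b * ((a + b) / 2) by rewrite ler_wpM2l.
  have := sqr_ge0 (a - b); rewrite expr2.
  have aa : 0 <= a * a by rewrite mulr_ge0.
  by move=> ? ? ?; lra.
have t4 : `|tau * (a * (q - 2 * y * d) - b * (p + 2 * x * d))| <= s * 2.
  by rewrite normrM ler_pM.
move: t2 t4; rewrite !ler_norml => /andP[t2 _] /andP[t4 _].
by lra.
Qed.

Lemma rot_gx_opp c a b x : rot_gx c (- a) b (- x) = - rot_gx c a b x.
Proof. by rewrite /rot_gx mulNr opprK; ring. Qed.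

Lemma rot_gx_even c a b x : rot_gx c a (- b) x = rot_gx c a b x.
Proof. by rewrite /rot_gx mulNr opprK; ring. Qed.

Lemma rot_ge c a b x y x0 y0 w tau r s : a * a + b * b = 1 ->
  x = x0 + w * a -> y = y0 + w * b -> c + a * x0 + b * y0 = 0 ->
  `|x0| <= 2^-1 -> `|y0| <= 2^-1 -> `|x| <= 2^-1 -> `|y| <= 2^-1 ->
  `|w| <= r -> `|tau| <= s ->
  - (r + 2 * s) <= rot_gx c a b x * (a - tau * b) + rot_gx c b a y * (b + tau * a).
Proof.
wlog a0 : a x x0 tau / 0 <= a.
  move=> H; have [a0|/ltW a0] := leP 0 a; first exact: H.
  move=> ab1 xE yE l0 x0b y0b xb yb ws ts.
  have := H (- a) (- x) (- x0) (- tau).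
  rewrite rot_gx_opp rot_gx_even !normrN oppr_ge0 => H'.
  suff : - (r + 2 * s) <= - rot_gx c a b x * (- a - - tau * b) +
      rot_gx c b a y * (b + - tau * - a) by congr (_ <= _); ring.
  apply: H' => //; first by rewrite mulrNN.
    by rewrite xE; ring.
  by rewrite -l0; ring.
wlog b0 : b y y0 tau / 0 <= b.
  move=> H; have [b0|/ltW b0] := leP 0 b; first exact: H.
  move=> ab1 xE yE l0 x0b y0b xb yb ws ts.
  have := H (- b) (- y) (- y0) (- tau).
  rewrite rot_gx_opp rot_gx_even !normrN oppr_ge0 => H'.
  suff : - (r + 2 * s) <= rot_gx c a b x * (a - - tau * - b) +
      - rot_gx c b a y * (- b + - tau * a) by congr (_ <= _); ring.
  apply: H' => //; first by rewrite mulrNN.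
    by rewrite yE; ring.
  by rewrite -l0; ring.
have low z : `|z| <= 2^-1 :> R -> - 2^-1 <= z by rewrite ler_norml => /andP[].
move=> ab1 xE yE l0 /low x0b /low y0b xb yb ws ts.
have [ab|/ltW ba] := leP a b.
  by apply: (rot_core c a b x y x0 y0 w) => //; rewrite a0.
suff : - (r + 2 * s) <= rot_gx c b a y * (b - - tau * a) + rot_gx c a b x * (a + - tau * b).
  by congr (_ <= _); ring.
apply: (rot_core c b a y x y0 x0 w) => //; rewrite ?b0 ?normrN // addrC //.
by rewrite -l0; ring.
Qed.
End Rotated.

(** * Unisolvence *)

Section LocalSpace.
Context {R : realType}.
Implicit Types (T : R * R * bool * bool) (h : R) (fam : fe_family) (X Y : R * R).

(** The default 0 lets formulas with four coefficients cover the triangular families too. *)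
Definition pcoef {fam} (p : 'rV[R]_(nloc fam)) (k : nat) : R :=
  if (k < nloc fam)%N then p 0 (inord k) else 0.

Lemma pcoefE fam (p : 'rV[R]_(nloc fam)) (j : 'I_(nloc fam)) : pcoef p j = p 0 j.
Proof. by rewrite /pcoef ltn_ord inord_val. Qed.

Lemma pcoefD fam (p q : 'rV[R]_(nloc fam)) (c : R) k :
  pcoef (p + c *: q) k = pcoef p k + c * pcoef q k.
Proof. by rewrite /pcoef; case: ifP => _; rewrite ?mxE ?mulr0 ?addr0. Qed.

Lemma pcoef_eq0 fam (p : 'rV[R]_(nloc fam)) : pcoef p 0 = 0 -> pcoef p 1 = 0 ->
  pcoef p 2 = 0 -> pcoef p 3 = 0 -> p = 0.
Proof.
move=> p0 p1 p2 p3; apply/rowP => j; rewrite -pcoefE mxE.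
by case: fam p p0 p1 p2 p3 j => p p0 p1 p2 p3 -[[|[|[|[|//]]]] lj].
Qed.

Lemma pevalE fam (p : 'rV[R]_(nloc fam)) X : peval p X =
  pcoef p 0 + pcoef p 1 * X.1 + pcoef p 2 * X.2 + pcoef p 3 * monomial fam 3 X.
Proof.
rewrite /peval.
have -> : \sum_(j < nloc fam) p 0 j * monomial fam j X =
    \sum_(j < nloc fam) pcoef p j * monomial fam j X.
  by apply: eq_bigr => j _; rewrite pcoefE.
case: fam p => p; rewrite ?big_ord3 ?big_ord4 /= mulr1 //.
all: by rewrite mulr0 addr0.
Qed.

Lemma dcoefE fam (p : 'rV[R]_(nloc fam)) : is_rect fam -> dcoef p = pcoef p 3.
Proof. by rewrite /dcoef -pcoefE; case: fam p. Qed.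

Lemma derive1_quadratic (f : R -> R) (u v w x : R) :
  (forall s, f s = u + v * s + w * s ^+ 2) -> derive1 f x = v + 2 * w * x.
Proof.
move=> fE; have -> : f = cst u + v *: id + w *: id ^+ 2 by apply/funext => s; rewrite fE.
have dx := is_derive_id x (1 : R).
have := is_deriveD (is_deriveD (is_derive_cst u x 1) (is_deriveZ v dx))
  (is_deriveZ w (is_deriveX 2 dx)).
move=> H; rewrite derive1E; have -> := @derive_val _ _ _ _ _ _ _ H.
by rewrite add0r expr1 -![_ *: _]/(_ * _); ring.
Qed.

(* Unqualified, [Bilinear] is a MathComp module and would be read as a pattern variable. *)
Definition dmonomial fam X : R * R :=
  match fam with
  | Defs.Bilinear => (X.2, X.1)
  | RotatedQ1 => (2 * X.1, - (2 * X.2))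
  | _ => (0, 0)
  end.

Lemma gradE fam (p : 'rV[R]_(nloc fam)) X : grad (peval p) X =
  (pcoef p 1 + pcoef p 3 * (dmonomial fam X).1, pcoef p 2 + pcoef p 3 * (dmonomial fam X).2).
Proof.
rewrite /grad; case: X => x y /=; congr (_, _).
- pose k : R := match fam with Defs.Bilinear => y | _ => 0 end.
  pose r : R := match fam with RotatedQ1 => 1 | _ => 0 end.
  rewrite (@derive1_quadratic _ (pcoef p 0 + pcoef p 2 * y - r * pcoef p 3 * y ^+ 2)
     (pcoef p 1 + k * pcoef p 3) (r * pcoef p 3)).
    by rewrite /k /r; case: fam p {k r} => p /=; ring.
  by move=> s; rewrite pevalE /k /r; case: fam p {k r} => p /=; ring.
- pose k : R := match fam with Defs.Bilinear => x | _ => 0 end.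
  pose r : R := match fam with RotatedQ1 => 1 | _ => 0 end.
  rewrite (@derive1_quadratic _ (pcoef p 0 + pcoef p 1 * x + r * pcoef p 3 * x ^+ 2)
     (pcoef p 2 + k * pcoef p 3) (- (r * pcoef p 3))).
    by rewrite /k /r; case: fam p {k r} => p /=; ring.
  by move=> s; rewrite pevalE /k /r; case: fam p {k r} => p /=; ring.
Qed.

End LocalSpace.

Section Nodal.
Context {R : realType}.
Variables (fam : fe_family) (h : R) (T : R * R * bool * bool).
Hypothesis h0 : h != 0.

Definition sgx : R := let: (_, sx, _) := T in (-1) ^+ sx.
Definition sgy : R := let: (_, _, sy) := T in (-1) ^+ sy.

Lemma sgx2 : sgx * sgx = 1. Proof. by rewrite /sgx; case: T => [[? ?] ?]; exact: sqr_sign. Qed.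
Lemma sgy2 : sgy * sgy = 1. Proof. by rewrite /sgy; case: T => [[? ?] ?]; exact: sqr_sign. Qed.

(** Gradient at (x, y), in reference coordinates, of the local polynomial with nodal values [u];
    edge midpoints are numbered counterclockwise from the bottom edge. *)
Definition ref_grad (u : nat -> R) (x y : R) : R * R :=
  match fam with
  | LinearP1 => (u 1%N - u 0%N, u 2%N - u 1%N)
  | CrouzeixRaviart => (2 * (u 1%N - u 2%N), 2 * (u 2%N - u 0%N))
  | Defs.Bilinear => ((1 - y) * (u 1%N - u 0%N) + y * (u 2%N - u 3%N),
                      (1 - x) * (u 3%N - u 0%N) + x * (u 2%N - u 1%N))
  | RotatedQ1 =>
      (u 1%N - u 3%N + 2 * (x - 2^-1) * (u 1%N + u 3%N - u 0%N - u 2%N),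
       u 2%N - u 0%N + 2 * (y - 2^-1) * (u 0%N + u 2%N - u 1%N - u 3%N))
  end.

Definition ref_node (k : nat) : R * R :=
  match fam with
  | LinearP1 | Defs.Bilinear => ref_vertex k
  | _ => match k with
         | 0 => (2^-1, 0) | 1 => (1, 2^-1)
         | 2 => if is_rect fam then (2^-1, 1) else (2^-1, 2^-1)
         | _ => (0, 2^-1) end
  end.

Lemma nodeE (i : 'I_(nloc fam)) : node h T i =
  (T.1.1.1 + sgx * h * (ref_node i).1, T.1.1.2 + sgy * h * (ref_node i).2).
Proof.
rewrite /sgx /sgy /ref_node; case: T => [[[p1 p2] sx] sy].
case: fam i => -[[|[|[|[|//]]]] li] //=.
all: by rewrite /node /midpoint; congr (_, _); rewrite /= -![_ *: _]/(_ * _); field.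
Qed.

Lemma ref_gradP (p : 'rV[R]_(nloc fam)) (u : nat -> R) X :
  (forall i : 'I_(nloc fam), peval p (node h T i) = u i) ->
  let Z := ref_coord h T X in
  (sgx * h * (grad (peval p) X).1, sgy * h * (grad (peval p) X).2) = ref_grad u Z.1 Z.2.
Proof.
move=> pu; rewrite gradE /=.
have {}pu k : (k < nloc fam)%N -> u k = peval p
    (T.1.1.1 + sgx * h * (ref_node k).1, T.1.1.2 + sgy * h * (ref_node k).2).
  by move=> lk; have := pu (Ordinal lk); rewrite nodeE /= => <-.
have [X1 X2] : X.1 = T.1.1.1 + sgx * h * (ref_coord h T X).1 /\
    X.2 = T.1.1.2 + sgy * h * (ref_coord h T X).2.
  have := ref_coordK h T X h0; rewrite /sgx /sgy.
  by case: T => [[[p1 p2] sx] sy] /= XE; split; rewrite {1}XE.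
move: X1 X2; case: (ref_coord h T X) => x y /=; case: X => X1 X2 /= -> ->.
move: sgx sgy sgx2 sgy2 pu => ax ay ax2 ay2 pu.
have u0 := pu 0 isT; have u1 := pu 1 isT; have u2 := pu 2 isT.
have u3 : is_rect fam -> u 3 = peval p
    (T.1.1.1 + ax * h * (ref_node 3).1, T.1.1.2 + ay * h * (ref_node 3).2).
  by move=> rf; apply: pu; case: fam rf.
move: u0 u1 u2 u3 {pu}; rewrite !pevalE /ref_grad /ref_node /=.
case: fam p => p /= -> -> -> u3; rewrite ?(u3 isT) {u3}.
- by congr (_, _); ring.
- by congr (_, _); field.
- by congr (_, _); ring.
- by congr (_, _); field: ax2 ay2.
Qed.

Definition node_mx : 'M[R]_(nloc fam) := \matrix_(j, i) monomial fam j (node h T i).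

Lemma node_mxE (p : 'rV[R]_(nloc fam)) i : (p *m node_mx) 0 i = peval p (node h T i).
Proof. by rewrite mxE /peval; apply: eq_bigr => j _; rewrite mxE. Qed.

(** Zero nodal values force a zero gradient everywhere by [ref_gradP], hence a constant, which one
    node makes zero. *)
Lemma node_mx_unit : node_mx \in unitmx.
Proof.
rewrite -row_free_unit; apply: inj_row_free => p pA.
have pu (i : 'I_(nloc fam)) : peval p (node h T i) = 0 by rewrite -node_mxE pA mxE.
have gx X : pcoef p 1 + pcoef p 3 * (dmonomial fam X).1 = 0 /\
            pcoef p 2 + pcoef p 3 * (dmonomial fam X).2 = 0.
  have := @ref_gradP p (fun=> 0) X pu; rewrite gradE /=.
  have -> : forall x y, ref_grad (fun=> 0) x y = (0, 0).
    by move=> x y; rewrite /ref_grad; case: fam; congr (_, _); ring.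
  have sx : sgx * h != 0.
    rewrite mulf_neq0 //; apply: contra_eq_neq sgx2 => ->.
    by rewrite mul0r eq_sym oner_eq0.
  have sy : sgy * h != 0.
    rewrite mulf_neq0 //; apply: contra_eq_neq sgy2 => ->.
    by rewrite mul0r eq_sym oner_eq0.
  by move=> [H1 H2]; split; [apply: (mulfI sx) | apply: (mulfI sy)]; rewrite mulr0.
(* At the origin the second degree term has zero gradient; at (1/2, 1) its first derivative is 1 for
   both rectangular families. *)
have [p1 p2] := gx 0; have [p1' p2'] := gx (2^-1, 1).
have p3 : pcoef p 3 = 0.
  move: p1 p2 p1' p2'; rewrite /dmonomial; case: fam p {pA pu gx} => p //=; lra.
move: p1 p2; rewrite p3 !mul0r !addr0 => p1 p2.
have := pu 0; rewrite pevalE p1 p2 p3 !mul0r !addr0 => p0.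
exact: pcoef_eq0.
Qed.

End Nodal.

Section LevelPolynomial.
Context {R : realType}.

Lemma pcoef_tri fam (p : 'rV[R]_(nloc fam)) : ~~ is_rect fam -> pcoef p 3 = 0.
Proof. by case: fam p. Qed.

Variables (fam : fe_family) (n D : R * R).

Definition level_poly : 'rV[R]_(nloc fam) :=
  \row_j match val j with 0 => - dot n D | 1 => n.1 | 2 => n.2 | _ => 0 end.

Lemma level_coef : [/\ pcoef level_poly 0 = - dot n D, pcoef level_poly 1 = n.1,
  pcoef level_poly 2 = n.2 & pcoef level_poly 3 = 0].
Proof.
by rewrite /pcoef /level_poly; case: fam => /=; split; rewrite ?mxE ?inordK.
Qed.
End LevelPolynomial.

(** * Reduction to a linear equation in one unknown *)

Section Unisolvence.
Context {R : realType}.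
Variables (fam : fe_family) (h bm bp L : R) (T : R * R * bool * bool).
Variables (Om : set (R * R)) (D E t n F nF : R * R).
Hypothesis h0 : h != 0.
Hypotheses (tt : dot t t = 1) (nn : dot n n = 1) (tn : dot t n = 0).
Hypotheses (L0 : 0 < L) (EE : E = D + L *: t).
Hypothesis in_neg : forall i : 'I_(nloc fam),
  Om (node h T i) -> dot n (node h T i - D) <= 0.
Hypothesis out_pos : forall i : 'I_(nloc fam),
  ~ Om (node h T i) -> 0 <= dot n (node h T i - D).

Notation lp := (level_poly fam n D).

Let flux (p : 'rV[R]_(nloc fam)) : R := dot (grad (peval p) F) nF.

Lemma peval_level X : peval lp X = dot n (X - D).
Proof.
have [l0 l1 l2 l3] := level_coef fam n D.
by rewrite pevalE l0 l1 l2 l3 /dot /=; ring.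
Qed.

Lemma pevalD (p q : 'rV[R]_(nloc fam)) c X :
  peval (p + c *: q) X = peval p X + c * peval q X.
Proof. by rewrite !pevalE !pcoefD; ring. Qed.

Lemma fluxD p q c : flux (p + c *: q) = flux p + c * flux q.
Proof. by rewrite /flux !gradE /dot /= !pcoefD; ring. Qed.

Lemma flux_level : flux lp = dot n nF.
Proof.
have [l0 l1 l2 l3] := level_coef fam n D.
by rewrite /flux gradE l1 l2 l3 /dot /=; ring.
Qed.

Lemma level_line X : line D E X -> dot n (X - D) = 0.
Proof.
move=> [s _ <-]; rewrite EE [D + L *: t]addrC addrK [D + _]addrC addrK !dotZr.
by rewrite dotC tn !mulr0.
Qed.

(** The difference has no second degree term, so it is affine; as it vanishes at D and E, its
    gradient is orthogonal to [t], hence along [n]. *)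
Lemma line_agreement (p q : 'rV[R]_(nloc fam)) :
  (forall X, line D E X -> peval p X = peval q X) ->
  (is_rect fam -> dcoef p = dcoef q) ->
  exists c, p = q + c *: lp.
Proof.
move=> pq dpq; pose d := p + (-1) *: q.
have dE X : line D E X -> peval d X = 0 by move=> /pq pX; rewrite pevalD pX; ring.
have d3 : pcoef d 3 = 0.
  rewrite pcoefD; have [rf|nrf] := boolP (is_rect fam).
    by rewrite -!dcoefE // (dpq rf); ring.
  by rewrite !pcoef_tri //; ring.
have lD : line D E D by exists 0 => //; rewrite scale0r addr0.
have lE : line D E E by exists 1 => //; rewrite scale1r addrC subrK.
pose V := (pcoef d 1, pcoef d 2).
have Vt : dot t V = 0.
  have := dE _ lE; have := dE _ lD; rewrite !pevalE d3 EE /= -![_ *: _]/(_ * _) => dD dE'.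
  apply: (mulfI (lt0r_neq0 L0)); rewrite mulr0 /dot /=; lra.
have := orthonormal_decomp t n V tt nn tn; rewrite Vt scale0r add0r.
set c := dot n V => VE; exists c.
have [l0 l1 l2 l3] := level_coef fam n D.
have V1 : pcoef d 1 = c * n.1 by rewrite -[LHS]/V.1 VE.
have V2 : pcoef d 2 = c * n.2 by rewrite -[LHS]/V.2 VE.
apply/eqP; rewrite -subr_eq0; apply/eqP.
suff <- : d + (- c) *: lp = p - (q + c *: lp).
  apply: pcoef_eq0; rewrite pcoefD ?l0 ?l1 ?l2 ?l3 ?V1 ?V2 ?d3; try ring.
  by have := dE _ lD; rewrite pevalE d3 V1 V2 /dot => <-; ring.
by rewrite /d scaleN1r scaleNr opprD addrA.
Qed.

(** The premise is K > 0, stated for every [q] with the nodal values of min(L, 0) so that the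
    inverse of the node matrix stays internal. *)
Lemma ife_unisolvent (v : 'rV[R]_(nloc fam)) :
  (forall q : 'rV[R]_(nloc fam),
     (forall i : 'I_(nloc fam), peval q (node h T i) = neg_part (dot n (node h T i - D))) ->
     0 < bm * dot n nF + (bp - bm) * flux q) ->
  exists! phi, ife_function h bm bp Om T D E F nF v phi.
Proof.
move=> Kpos.
pose u : 'rV[R]_(nloc fam) := \row_(i < nloc fam) neg_part (dot n (node h T i - D)).
pose interp w : 'rV[R]_(nloc fam) := w *m invmx (node_mx fam h T).
have unitA : node_mx fam h T \in unitmx by exact: node_mx_unit.
have interpE w (i : 'I_(nloc fam)) : peval (interp w) (node h T i) = w 0 i.
  by rewrite -node_mxE mulmxKV.
have interp_uniq (p w : 'rV[R]_(nloc fam)) :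
    (forall i : 'I_(nloc fam), peval p (node h T i) = w 0 i) -> p = interp w.
  move=> pw; rewrite /interp; have -> : w = p *m node_mx fam h T.
    by apply/rowP => i; rewrite node_mxE pw.
  by rewrite mulmxK.
pose q := interp u.
pose K := bm * dot n nF + (bp - bm) * flux q.
have K0 : 0 < K by apply: Kpos => i; rewrite interpE mxE.
pose c := (bp - bm) * flux (interp v) / K.
(* The branch of [glue] adds [e] times the level at nodes in [Om], where the level is nonpositive,
   and 0 at the others: in both cases e min(L, 0). *)
have glueE (p : 'rV[R]_(nloc fam)) (e : R) (i : 'I_(nloc fam)) :
    Defs.glue Om (p + e *: lp, p) (node h T i) =
    peval p (node h T i) + e * u 0 i.
  rewrite /Defs.glue mxE; case: ifPn => [/set_mem|/negP] io /=.
    by rewrite pevalD peval_level /neg_part min_l // in_neg.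
  rewrite /neg_part min_r ?mulr0 ?addr0 // out_pos // => ?; apply: io; exact/mem_set.
have fluxE (p : 'rV[R]_(nloc fam)) (e : R) : (bm * flux (p + e *: lp) = bp * flux p) <->
    (bm * e * dot n nF = (bp - bm) * flux p).
  rewrite fluxD flux_level; split=> H; first by rewrite mulrBl -H; ring.
  by rewrite mulrDr mulrA H; ring.
(* Subtracting [c *: q] cancels the contribution of [c] at the nodes; the flux condition then reads
   c K = (bp - bm) flux (interp v). *)
pose p2 := interp v + (- c) *: q.
exists (p2 + c *: lp, p2); split.
  split=> /=.
  - by move=> X /level_line lX; rewrite pevalD peval_level lX mulr0 addr0.
  - have [_ _ _ l3] := level_coef fam n D.
    by move=> rf; rewrite !dcoefE // pcoefD l3 mulr0 addr0.
  - rewrite -/(flux _) -/(flux p2); apply/fluxE; rewrite fluxD.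
    have -> : flux (interp v) + - c * flux q = flux (interp v) - c * flux q by ring.
    rewrite mulrBr; apply/eqP; rewrite eq_sym subr_eq; apply/eqP.
    have -> : (bp - bm) * flux (interp v) = c * K by rewrite /c divfK // gt_eqF.
    by rewrite /K; ring.
  - by move=> i; rewrite glueE pevalD !interpE; ring.
move=> [p1 p2'] [/= lineP dP fluxP glueP].
have [e p1E] := line_agreement p1 p2' lineP dP; subst p1.
have p2'E : p2' = interp v + (- e) *: q.
  have -> : interp v + - e *: q = interp (v + (- e) *: u).
    by rewrite /interp mulmxDl -scalemxAl.
  by apply: interp_uniq => i; rewrite mxE [(_ *: u) 0 i]mxE -glueP glueE; ring.
suff cE : c = e by rewrite /p2 cE -p2'E.
move: fluxP; rewrite -!/(flux _) => /fluxE; rewrite p2'E fluxD => H.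
rewrite /c; apply: (mulIf (lt0r_neq0 K0)); rewrite divfK ?gt_eqF // /K.
have -> : e * (bm * dot n nF + (bp - bm) * flux q) =
  bm * e * dot n nF + (bp - bm) * (e * flux q) by ring.
by rewrite H; ring.
Qed.
End Unisolvence.

(** * The flux in reference coordinates *)

Section FluxInRefCoordinates.
Context {R : realType}.
Variables (fam : fe_family) (h : R) (T : R * R * bool * bool) (D n F nF : R * R).
Hypothesis h_gt0 : 0 < h.

Let h0 : h != 0 := lt0r_neq0 h_gt0.

(** Coefficients of the level in reference coordinates, divided by [h] so that ([lev1], [lev2]) is a
    unit vector when [n] is. *)
Definition lev0 : R := dot n (T.1.1 - D) / h.
Definition lev1 : R := sgx T * n.1.
Definition lev2 : R := sgy T * n.2.

Lemma ref_level_gen (x y : R) :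
  dot n ((T.1.1.1 + sgx T * h * x, T.1.1.2 + sgy T * h * y) - D) =
  h * (lev0 + lev1 * x + lev2 * y).
Proof. by rewrite /lev0 /lev1 /lev2 /dot /=; field. Qed.

Lemma ref_coordE X : X = (T.1.1.1 + sgx T * h * (ref_coord h T X).1,
                          T.1.1.2 + sgy T * h * (ref_coord h T X).2).
Proof.
by have := ref_coordK h T X h0; rewrite /sgx /sgy; case: T => [[[p1 p2] sx] sy].
Qed.

Lemma ref_level X : dot n (X - D) =
  h * (lev0 + lev1 * (ref_coord h T X).1 + lev2 * (ref_coord h T X).2).
Proof. by rewrite {1}(ref_coordE X) ref_level_gen. Qed.

Lemma neg_part_scale (x : R) : neg_part (h * x) = h * neg_part x.
Proof.
rewrite /neg_part; have [x0|x0] := leP x 0.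
  by rewrite min_l // pmulr_rle0.
by rewrite min_r ?mulr0 // ltW // mulr_gt0.
Qed.

Definition ref_neg (k : nat) : R :=
  neg_part (lev0 + lev1 * (ref_node fam k).1 + lev2 * (ref_node fam k).2).

Lemma flux_ref (q : 'rV[R]_(nloc fam)) :
  (forall i : 'I_(nloc fam), peval q (node h T i) = neg_part (dot n (node h T i - D))) ->
  let Z := ref_coord h T F in let g := ref_grad fam ref_neg Z.1 Z.2 in
  dot (grad (peval q) F) nF = g.1 * (sgx T * nF.1) + g.2 * (sgy T * nF.2).
Proof.
move=> qE Z g.
have := ref_gradP fam h T h0 q (fun k => h * ref_neg k) F.
rewrite -/Z; move: (grad (peval q) F) => G H.
have {H} : (sgx T * h * G.1, sgy T * h * G.2) = (h * g.1, h * g.2).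
  rewrite H => [|i]; last by rewrite qE nodeE ref_level_gen neg_part_scale.
  by rewrite /g /ref_grad; case: fam => /=; congr (_, _); ring.
move: g => g [gx gy].
have gx' : g.1 = sgx T * G.1 by apply: (mulfI h0); rewrite -gx; ring.
have gy' : g.2 = sgy T * G.2 by apply: (mulfI h0); rewrite -gy; ring.
rewrite gx' gy'.
transitivity ((sgx T * sgx T) * (G.1 * nF.1) + (sgy T * sgy T) * (G.2 * nF.2)).
  by rewrite sgx2 sgy2 !mul1r.
by ring.
Qed.

(** Each component of these gradients is a difference quotient of min(L, 0) between two nodes on a
    parallel to an axis, and the matching component of the normal is that of L. *)
Lemma ref_grad_mono : fam = LinearP1 \/ fam = CrouzeixRaviart -> forall x y,
  0 <= (ref_grad fam ref_neg x y).1 * lev1 + (ref_grad fam ref_neg x y).2 * lev2.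
Proof.
have mono (u v k : R) : v - u = k -> 0 <= (neg_part v - neg_part u) * k.
  by move=> <-; exact: neg_part_mono.
move=> [] fE x y; rewrite /ref_grad /ref_neg /ref_node fE /=.
- by apply: addr_ge0; apply: mono; ring.
- have mono2 (u v k : R) : v - u = k / 2 -> 0 <= 2 * (neg_part v - neg_part u) * k.
    move=> vu; have -> : 2 * (neg_part v - neg_part u) * k =
      4 * ((neg_part v - neg_part u) * (k / 2)) by field.
    by rewrite mulr_ge0 // mono.
  by apply: addr_ge0; apply: mono2; field.
Qed.

End FluxInRefCoordinates.

(** * The local frame and the slope of the interface *)

Section Frame.
Context {R : realType}.
Implicit Types (w : R -> R).

Lemma node_boundary fam h T (i : 'I_(nloc fam)) :
  @elt_boundary R fam h T (node h T i).
Proof.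
exists i; have h1 : 2^-1 \in `[(0:R), 1] by rewrite in_itv /=; apply/andP; split; lra.
have mid (A B : R * R) : segment A B (midpoint A B).
  exists 2^-1 => //; rewrite /midpoint; case: A B => [? ?] [? ?].
  by congr (_, _); rewrite /= -![_ *: _]/(_ * _); field.
have left (A B : R * R) : segment A B A.
  by exists 0; rewrite /= ?in_itv /= ?lexx ?ler01 // scale0r addr0.
by rewrite /node /edge; case: fam i => i.
Qed.

Lemma derive1_opp w (x : R) : derivable w x 1 -> derive1 (fun s => - w s) x = - derive1 w x.
Proof. by move=> wd; rewrite !derive1E deriveN. Qed.

Lemma C2_opp w : C2 w -> C2 (fun s => - w s).
Proof.
move=> [wd wc]; have d1 : derive1 (fun s => - w s) = (fun s => - derive1 w s).
  by apply/funext => s; rewrite derive1_opp //; case: (wd s).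
have d2 : derive1 (derive1 (fun s => - w s)) = (fun s => - derive1 (derive1 w) s).
  by apply/funext => s; rewrite d1 derive1_opp //; case: (wd s).
split; last by rewrite d2 => x; apply: cvgN; exact: wc.
by move=> x; have [? ?] := wd x; rewrite d1; split; exact: derivableN.
Qed.

Lemma orthonormal_pm (t m n : R * R) : dot t t = 1 -> dot m m = 1 -> dot t m = 0 ->
  dot n n = 1 -> dot t n = 0 -> n = m \/ n = - m.
Proof.
move=> tt mm tm nn tn; have nE := orthonormal_decomp t m n tt mm tm.
move: nE; rewrite tn scale0r add0r; move: (dot m n) => e nE.
have e2 : e ^+ 2 = 1.
  by move: nn; rewrite nE dotZr dotC dotZr mm mulr1 expr2.
by move/eqP: e2; rewrite sqrf_eq1 => /orP[] /eqP eE; [left|right];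
  rewrite nE eE ?scale1r ?scaleN1r.
Qed.

(** The graph comes with some unit normal of DE, either [nbar] or its opposite; in the second case
    [w] changes sign. *)
Lemma interface_frame fam h (Gamma Om Op : set (R * R)) Th T (D E nbar : R * R) :
  interface_hypotheses fam h Gamma Th -> T \in Th -> interface_element fam h Gamma T ->
  cuts_at fam h Gamma T D E -> oriented_line_normal fam h Gamma Om Op T D E nbar ->
  exists t L w, [/\ dot t t = 1, dot t nbar = 0, E = D + L *: t &
    C2_graph (Gamma `&` elt_set fam h T) D t nbar L w].
Proof.
move=> [_ _ _ gr] TTh Tint cut [nn nDE _].
have [n [w [[tt mm] tm L0 wC2 GE]]] := gr T D E TTh Tint cut.
set L := enorm (E - D) in tt tm L0 GE; set t := L^-1 *: (E - D) in tt tm GE.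
have tn : dot t nbar = 0 by rewrite dotC dotZr nDE mulr0.
exists t, L.
have EE : E = D + L *: t by rewrite /t scalerA divff ?gt_eqF // scale1r addrC subrK.
have [nE|nE] := orthonormal_pm t n nbar tt mm tm nn tn.
  by exists w; rewrite nE in tn nn *; split.
exists (fun s => - w s); split; [exact: tt|exact: tn|exact: EE|].
split; [by split|exact: tn|exact: L0|exact: C2_opp|].
rewrite GE nE; apply/seteqP; split => X [s sL <-]; exists s; try exact: sL.
all: by rewrite scaleNr scalerN opprK.
Qed.
End Frame.

Section Smallness.
Context {R : realType}.

(** The power has its base in (0, 1] and a negative exponent, hence is at least 1. *)
Lemma smallness_bound (h eps kbar kappa : R) : 0 < eps < Num.sqrt 2 / 2 ->
  0 < kbar <= 1 -> 0 <= h * kappa -> smallness h eps kbar kappa ->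
  Num.sqrt 2 * (h * kappa) <= Num.sqrt kbar / 2.
Proof.
move=> /andP[e0 e2] /andP[k0 k1] hk0; rewrite /smallness lt_min => /andP[H _].
set P := _ `^ _ in H.
have s2 : 0 < Num.sqrt 2 :> R by rewrite sqrtr_gt0.
have P1 : 1 <= P.
  have ee : eps ^+ 2 < 2^-1.
    have : eps ^+ 2 < (Num.sqrt 2 / 2) ^+ 2.
      by rewrite ltrXn2r ?nnegrE ?ltW // divr_ge0 // ltW.
    by rewrite expr_div_n sqr_sqrtr //; move/lt_le_trans; apply; lra.
  have ee0 := sqr_ge0 eps.
  have [g0 g1] : 0 < 1 - 2 * eps ^+ 2 /\ 1 - 2 * eps ^+ 2 <= 1 by split; lra.
  rewrite /P powRN invf_ge1 ?powR_gt0 //.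
  have r0 : 0 <= 3 / 2 :> R by lra.
  have := @ge0_ler_powR R _ r0 (1 - 2 * eps ^+ 2) 1.
  by rewrite !nnegrE powR1 /=; apply => //; exact: ltW.
move: H; rewrite ltr_pdivlMr ?mulr_gt0 //; last by lra.
move=> H; rewrite ler_pdivlMr //; apply: le_trans (ltW H).
have -> : Num.sqrt 2 * (h * kappa) * 2 = h * kappa * (Num.sqrt 2 * 2) by ring.
by rewrite ler_wpM2l // ler_wpM2l ?(ltW s2) //; lra.
Qed.

End Smallness.

Section InterfaceSlope.
Context {R : realType}.
Variables (fam : fe_family) (h : R) (T : R * R * bool * bool).
Hypothesis h_gt0 : 0 < h.

Lemma elt_ref_square X : elt_set fam h T X ->
  [/\ 0 <= (ref_coord h T X).1 <= 1 & 0 <= (ref_coord h T X).2 <= 1].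
Proof.
move=> /(elt_setP _ _ _ _ (lt0r_neq0 h_gt0)); rewrite /edge_form.
case: (ref_coord h T X) => x y /= f; have := f 0; have := f 1; have := f 2%:R.
have : is_rect fam -> 0 <= x by move=> rf; have := f (inord 3); rewrite inordK //; case: fam rf.
rewrite /=; case: (is_rect fam) => [/(_ isT)|_] /= *; split; apply/andP; split; lra.
Qed.

Lemma boundary_ref_square X : is_rect fam -> elt_boundary fam h T X ->
  on_square_boundary (ref_coord h T X).1 (ref_coord h T X).2.
Proof.
move=> rf [i /(edgeP _ _ _ _ _ (lt0r_neq0 h_gt0))[TX]].
have [x01 y01] := elt_ref_square X TX; rewrite /edge_form; move: x01 y01.
case: (ref_coord h T X) => x y /= x01 y01; rewrite rf => fX; split => //.
move: fX; case: (val i) => [|[|[|k]]] fX.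
- by constructor 3.
- by constructor 2; lra.
- by constructor 4; lra.
- by constructor 1.
Qed.

Lemma elt_diam (D E t : R * R) (L : R) : dot t t = 1 -> E = D + L *: t ->
  elt_set fam h T D -> elt_set fam h T E -> L ^+ 2 <= 2 * h ^+ 2.
Proof.
move=> tt EE TD TE; have [dx dy] := elt_ref_square D TD.
have [ex ey] := elt_ref_square E TE.
have LE : L ^+ 2 = dot (E - D) (E - D).
  by rewrite EE [D + _]addrC addrK dotZr dotC dotZr tt mulr1 expr2.
rewrite LE (ref_coordE h T h_gt0 E) (ref_coordE h T h_gt0 D) /dot /=.
move: dx dy ex ey; case: (ref_coord h T D) => dx dy; case: (ref_coord h T E) => ex ey /=.
move=> /andP[? ?] /andP[? ?] /andP[? ?] /andP[? ?].
have sq (u v : R) : 0 <= u -> u <= 1 -> 0 <= v -> v <= 1 -> (u - v) ^+ 2 <= 1.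
  move=> u0 u1 v0 v1; rewrite -real_normK ?num_real // expr_le1 // ler_norml.
  by apply/andP; split; lra.
have -> : forall p q : R, (p + sgx T * h * ex - (p + sgx T * h * dx)) *
    (p + sgx T * h * ex - (p + sgx T * h * dx)) +
    (q + sgy T * h * ey - (q + sgy T * h * dy)) *
    (q + sgy T * h * ey - (q + sgy T * h * dy)) =
    h ^+ 2 * ((sgx T * sgx T) * (ex - dx) ^+ 2 + (sgy T * sgy T) * (ey - dy) ^+ 2).
  by move=> p q; ring.
rewrite sgx2 sgy2 !mul1r [leRHS]mulrC ler_wpM2l ?sqr_ge0 //.
by rewrite -[leRHS]/(1 + 1) lerD // sq.
Qed.

Lemma interface_slope (Gamma : set (R * R)) (D E t n : R * R) (L eps kbar kappa : R) w :
  cuts_at fam h Gamma T D E -> dot t t = 1 -> E = D + L *: t ->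
  C2_graph (Gamma `&` elt_set fam h T) D t n L w ->
  max_curvature Gamma kappa -> 0 < eps < Num.sqrt 2 / 2 -> 0 < kbar <= 1 ->
  smallness h eps kbar kappa ->
  [/\ forall s, 0 <= s <= L -> `|derive1 w s| <= Num.sqrt kbar,
      L <= Num.sqrt 2 * h &
      forall s, 0 <= s <= L -> `|w s| <= Num.sqrt kbar * s].
Proof.
move=> cut tt EE gr [curv kbound] eps2 kbar1 small.
have h0 := lt0r_neq0 h_gt0.
have [[_ nn] tn L0 wC2 GT] := gr.
have [w0 wL] : w 0 = 0 /\ w L = 0.
  by apply: (graph_endpoints fam h T Gamma D E t n L w).
have kappa0 : 0 <= kappa.
  by move: curv => [C [P [t' [n' [L' [w' [s [_ _ _ ->]]]]]]]]; rewrite divr_ge0 // powR_ge0.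
have hk := smallness_bound h eps kbar kappa eps2 kbar1 (mulr_ge0 (ltW h_gt0) kappa0) small.
have LD : L <= Num.sqrt 2 * h.
  have [gD bD] := cut_D fam h T Gamma D E cut; have [gE bE] := cut_E fam h T Gamma D E cut.
  have := elt_diam D E t L tt EE (boundary_elt fam h T h0 D bD) (boundary_elt fam h T h0 E bE).
  have sh : 0 <= Num.sqrt 2 * h by rewrite mulr_ge0 ?sqrtr_ge0 // ltW.
  by rewrite -[_ <= _ * h](ler_sqr (ltW L0) sh) exprMn sqr_sqrtr.
have k01 : 0 <= Num.sqrt kbar <= 1.
  by rewrite sqrtr_ge0 -[leRHS]sqrtr1 ler_wsqrtr //; case/andP: kbar1.
have slope s : 0 <= s <= L -> `|derive1 w s| <= Num.sqrt kbar.
  move=> s0L; apply: slope_le k01 _.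
  (* The arc of [Gamma] in [T] is itself one of the graphs over which the maximum curvature is
     taken. *)
  have curvs z : 0 <= z <= L -> `|derive1 (derive1 w) z| /
      (1 + derive1 w z ^+ 2) `^ (3 / 2) <= kappa.
    move=> zL; apply: kbound.
    exists (Gamma `&` elt_set fam h T), D, t, n, L, w, z.
    by split; [exact: gr | move=> X [] | rewrite in_itv | ].
  apply: le_trans (slope_bound w L kappa L0 wC2 w0 wL curvs s s0L) _.
  apply: le_trans hk; rewrite [kappa * L]mulrC.
  by rewrite [Num.sqrt 2 * _]mulrA ler_wpM2r.
split => // s s0L; have [wd _] := wC2.
have dw z : is_derive z (1 : R) w (derive1 w z).
  by apply: is_derive_derive1; case: (wd z).
have := lipschitz_of_derive w _ (Num.sqrt kbar) 0 L s 0 dw slope s0L.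
rewrite w0 !subr0 lexx ltW // => /(_ isT); case/andP: s0L => s0 _.
by rewrite (ger0_norm s0).
Qed.
End InterfaceSlope.

Section Transmission.
Context {R : realType}.
Variables (fam : fe_family) (h : R) (T : R * R * bool * bool) (D n : R * R).
Hypothesis h_gt0 : 0 < h.
Hypothesis nn : dot n n = 1.

Notation lev0 := (lev0 h T D n).
Notation lev1 := (lev1 T n).
Notation lev2 := (lev2 T n).

Lemma lev_unit : lev1 * lev1 + lev2 * lev2 = 1.
Proof.
rewrite /lev1 /lev2; transitivity ((sgx T * sgx T) * (n.1 * n.1) + (sgy T * sgy T) * (n.2 * n.2)).
  by ring.
by rewrite sgx2 sgy2 !mul1r -nn.
Qed.

Lemma ref_coord_shift X (Y : R * R) : ref_coord h T (X + Y) =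
  ((ref_coord h T X).1 + sgx T * Y.1 / h, (ref_coord h T X).2 + sgy T * Y.2 / h).
Proof.
by rewrite /sgx /sgy; case: T => [[[p1 p2] sx] sy]; congr (_, _); rewrite /=; ring.
Qed.

Lemma ref_coord_midpoint X Y : ref_coord h T (midpoint X Y) =
  (((ref_coord h T X).1 + (ref_coord h T Y).1) / 2,
   ((ref_coord h T X).2 + (ref_coord h T Y).2) / 2).
Proof.
have h0 := lt0r_neq0 h_gt0.
by rewrite /midpoint; case: T => [[[p1 p2] sx] sy]; congr (_, _);
  rewrite /= -![_ *: _]/(_ * _); field.
Qed.

(* [tau] is, up to sign, the tangent of the angle between [nF] and [n]. *)
Lemma tilted_normal (t nF : R * R) (d : R) : dot t t = 1 -> dot t n = 0 ->
  dot nF t + d * dot nF n = 0 ->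
  exists2 tau, `|tau| = `|d| &
    sgx T * nF.1 = dot nF n * (lev1 - tau * lev2) /\
    sgy T * nF.2 = dot nF n * (lev2 + tau * lev1).
Proof.
move=> tt tn nFt.
have nFE := orthonormal_decomp t n nF tt nn tn.
have {nFE} nFE : nF = - d * dot nF n *: t + dot nF n *: n.
  by rewrite {1}nFE (dotC n nF) (dotC t nF) -[dot nF t]addr0
    -{1}(subrr (d * dot nF n)) addrA nFt sub0r mulNr.
have [e e2 tE] : exists2 e : R, e = 1 \/ e = - 1 & t = e *: (- n.2, n.1).
  have nt : dot n t = 0 by rewrite dotC.
  have [||tE|tE] := orthonormal_pm n (- n.2, n.1) t nn _ _ tt nt.
  - by rewrite -nn /dot /=; ring.
  - by rewrite /dot /=; ring.
  - by exists 1; [left|rewrite scale1r].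
  - by exists (- 1); [right|rewrite scaleN1r].
move: (dot nF n) nFE => b ->; rewrite tE.
(* Up to the sign [e], t is n turned by a right angle; each reflection of [T] reverses the sense of
   this turn. *)
pose f := e * (sgx T * sgy T).
have fn : `|f| = 1.
  rewrite /f /sgx /sgy normrM; case: T => [[_ sx] sy]; rewrite normrM !normr_sign !mulr1.
  by case: e2 => ->; rewrite ?normrN normr1.
exists (- f * d); first by rewrite normrM normrN fn mul1r.
rewrite /lev1 /lev2 /f /=; rewrite -![_ *: _]/(_ * _); split.
- transitivity (b * (sgx T * n.1 + d * e * (sgx T * n.2))); first by ring.
  transitivity (b * (sgx T * n.1 + d * e * ((sgy T * sgy T) * (sgx T * n.2)))); last by ring.
  by rewrite sgy2 mul1r.
- transitivity (b * (sgy T * n.2 - d * e * (sgy T * n.1))); first by ring.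
  transitivity (b * (sgy T * n.2 - d * e * ((sgx T * sgx T) * (sgy T * n.1)))); last by ring.
  by rewrite sgx2 mul1r.
Qed.

Lemma ref_grad_bilin (x y : R) :
  ref_grad Defs.Bilinear (ref_neg Defs.Bilinear h T D n) x y =
  (bilin_gx lev0 lev1 lev2 y, bilin_gx lev0 lev2 lev1 x).
Proof.
rewrite /ref_grad /ref_neg /ref_node /bilin_gx /= !mulr0 !mulr1 !addr0.
by rewrite [lev0 + lev2 + lev1]addrAC.
Qed.

Lemma ref_grad_rot (x y : R) : let c := lev0 + lev1 / 2 + lev2 / 2 in
  ref_grad RotatedQ1 (ref_neg RotatedQ1 h T D n) x y =
  (rot_gx c lev1 lev2 (x - 2^-1), rot_gx c lev2 lev1 (y - 2^-1)).
Proof.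
rewrite /ref_grad /ref_neg /ref_node /rot_gx /= !mulr0 !mulr1 !addr0.
move: lev0 lev1 lev2 => c a b.
have -> : c + a / 2 + b / 2 + a / 2 = c + a + b / 2 by field.
have -> : c + a / 2 + b / 2 - a / 2 = c + b / 2 by field.
have -> : c + a / 2 + b / 2 + b / 2 = c + a / 2 + b by field.
have -> : c + a / 2 + b / 2 - b / 2 = c + a / 2 by field.
by congr (_, _); ring.
Qed.
End Transmission.

(** * The sides of the line and the subdomains *)

Section InterfaceSides.
Context {R : realType}.

Lemma interface_sides fam h (Omega Gamma Om Op : set (R * R)) G Th T (D E t n : R * R)
    (L : R) w :
  separates Gamma Omega Om Op -> cartesian_mesh fam h G Omega Th -> T \in Th ->
  interface_element fam h Gamma T -> cuts_at fam h Gamma T D E ->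
  oriented_line_normal fam h Gamma Om Op T D E n ->
  dot t t = 1 -> dot t n = 0 -> E = D + L *: t ->
  C2_graph (Gamma `&` elt_set fam h T) D t n L w ->
  [/\ forall X, elt_boundary fam h T X -> 0 < dot n (X - D) -> Op X,
      forall X, elt_boundary fam h T X -> dot n (X - D) < 0 -> Om X &
      forall X, Om X -> Op X -> False].
Proof.
move=> [OmegaE sepOmOp _ _ _] [h_gt0 _ _ OmegaT] TTh [X0 [X0int gX0]] cut
  [nn _ crossing] tt tn EE [_ _ L0 _ GE].
have h0 := lt0r_neq0 h_gt0.
have sideT X : elt_set fam h T X -> ~ Gamma X -> Om X \/ Op X.
  move=> TX gX; have : (Omega `\` Gamma) X.
    by split => //; rewrite OmegaT; exists T.
  by rewrite OmegaE.
have X0_gt0 (i : 'I_(nloc fam)) : 0 < edge_form fam h T i X0.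
  exact: interior_edge_form_gt0 h0 X0int (ltn_ord i).
have cr := crossing X0 X0int gX0.
split.
- move=> X bX Xn.
  apply: (pos_boundary_in fam h T Gamma Op Om D E t n L w h0 _ _ cut tt nn tn L0 EE GE
    X0 X X0_gt0 gX0 _ bX Xn).
  + by rewrite separatedC.
  + by move=> Y TY gY; rewrite orC; exact: sideT.
  + by apply: filterS cr => s [].
- move=> X bX Xn.
  have GE' : Gamma `&` elt_set fam h T =
      [set D + s *: t + (- w s) *: (- n) | s in `[0, L]].
    by rewrite GE; apply/seteqP; split => Y [s sL <-]; exists s => //;
      rewrite scaleNr scalerN opprK.
  apply: (pos_boundary_in fam h T Gamma Om Op D E t (- n) L (fun s => - w s)
    h0 sepOmOp sideT cut tt _ _ L0 EE GE' X0 X X0_gt0 gX0 _ bX).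
  + by rewrite dotNl dotNr opprK.
  + by rewrite dotNr tn oppr0.
  + by apply: filterS cr => s []; rewrite scalerN.
  + by rewrite dotNl oppr_gt0.
- move=> X OmX OpX; have := separated_disjoint sepOmOp.
  by rewrite predeqE => /(_ X)[+ _]; apply.
Qed.
End InterfaceSides.

(** * Positivity of the transmission coefficient K *)

Section FluxBounds.
Context {R : realType}.
Variables (h : R) (T : R * R * bool * bool) (D E t n F nF : R * R) (L s m : R).
Variable w : R -> R.
Hypothesis h_gt0 : 0 < h.
Hypotheses (tt : dot t t = 1) (nn : dot n n = 1) (tn : dot t n = 0).
Hypotheses (L0 : 0 < L) (EE : E = D + L *: t).
Hypotheses (s0L : 0 <= s <= L) (FE : F = D + s *: t + w s *: n).
Hypotheses (nF0 : 0 < dot nF n) (nFt : dot nF t + derive1 w s * dot nF n = 0).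
Hypotheses (slope : `|derive1 w s| <= m) (ampl : `|w s| <= m * s).
Hypothesis L_le : L <= Num.sqrt 2 * h.

(** |w s| <= m s <= m L <= m sqrt 2 h, and sqrt 2 <= 3/2. *)
Lemma amplitude_le : `|w s / h| * 2 <= 3 * m.
Proof.
have m0 : 0 <= m by apply: le_trans slope.
have s2 : Num.sqrt 2 * 2 <= 3 :> R.
  have : Num.sqrt 2 <= Num.sqrt ((3 / 2) ^+ 2) :> R by rewrite ler_wsqrtr //; lra.
  by rewrite sqrtr_sqr ger0_norm //; lra.
rewrite normrM normfV (gtr0_norm h_gt0) mulrAC ler_pdivrMr //.
have : m * s <= m * (Num.sqrt 2 * h).
  by rewrite ler_wpM2l // (le_trans _ L_le) //; case/andP: s0L.
have : m * h * (Num.sqrt 2 * 2) <= m * h * 3 by rewrite ler_wpM2l // mulr_ge0 // ltW.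
by move: ampl => ? ? ?; lra.
Qed.

Lemma ref_level_D : lev0 h T D n + lev1 T n * (ref_coord h T D).1 +
  lev2 T n * (ref_coord h T D).2 = 0.
Proof.
apply: (mulfI (lt0r_neq0 h_gt0)); rewrite -ref_level // subrr mulr0.
by rewrite /dot /= !mulr0 addr0.
Qed.

Lemma ref_level_foot (r : R) : lev0 h T D n + lev1 T n * (ref_coord h T (D + r *: t)).1 +
  lev2 T n * (ref_coord h T (D + r *: t)).2 = 0.
Proof.
apply: (mulfI (lt0r_neq0 h_gt0)); rewrite -ref_level // mulr0.
by rewrite addrC addKr dotZr dotC tn mulr0.
Qed.

Lemma lev1_le : `|lev1 T n| <= 1.
Proof.
have := lev_unit T n nn; have := sqr_ge0 (lev2 T n); rewrite expr2 => ? ?.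
by rewrite -[leRHS]ger0_norm // -ler_sqr ?nnegrE // !real_normK ?num_real // expr1n expr2; lra.
Qed.

Lemma lev2_le : `|lev2 T n| <= 1.
Proof.
have := lev_unit T n nn; have := sqr_ge0 (lev1 T n); rewrite expr2 => ? ?.
by rewrite -[leRHS]ger0_norm // -ler_sqr ?nnegrE // !real_normK ?num_real // expr1n expr2; lra.
Qed.

Lemma flux_bilin (q : 'rV[R]_(nloc Defs.Bilinear)) :
  elt_boundary Defs.Bilinear h T D -> elt_boundary Defs.Bilinear h T E ->
  elt_set Defs.Bilinear h T F ->
  proj_line D E F = midpoint D E -> m < (4 * Num.sqrt 2)^-1 ->
  (forall i : 'I_(nloc Defs.Bilinear), peval q (node h T i) = neg_part (dot n (node h T i - D))) ->
  0 <= dot (grad (peval q) F) nF.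
Proof.
move=> bD bE TF projF m_lt qE; have h0 := lt0r_neq0 h_gt0.
have m0 : 0 <= m by apply: le_trans slope.
have s2 : 5 / 4 <= Num.sqrt 2 :> R.
  have : Num.sqrt ((5 / 4) ^+ 2) <= Num.sqrt 2 :> R by rewrite ler_wsqrtr //; lra.
  by rewrite sqrtr_sqr ger0_norm //; lra.
have m_le : m * (4 * Num.sqrt 2) <= 1.
  by rewrite -ler_pdivlMr ?mul1r ?ltW // mulr_gt0 //; lra.
have m5 : m <= 5^-1.
  have : m * 5 <= m * (4 * Num.sqrt 2) by rewrite ler_wpM2l //; lra.
  by lra.
have FD : F - D = s *: t + w s *: n by rewrite FE addrAC [D + _]addrC addrK.
have ED : E - D = L *: t by rewrite EE addrC addKr.
have sE : s = L / 2.
  have mid : midpoint D E = D + (L / 2) *: t.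
    rewrite /midpoint EE; case: D t => [? ?] [? ?].
    by congr (_, _); rewrite /= -![_ *: _]/(_ * _); field.
  have d1 : dot (F - D) (E - D) = L * s.
    by rewrite ED dotZr dotC FD dotDr !dotZr tt tn; ring.
  have d2 : dot (E - D) (E - D) = L * L by rewrite ED dotZr dotC dotZr tt mulr1.
  move: projF; rewrite mid /proj_line d1 d2 ED => /addrI/(congr1 (dot t)).
  rewrite !dotZr tt !mulr1 => <-; field.
  exact: lt0r_neq0.
have FE' : F = midpoint D E + w s *: n.
  rewrite FE sE EE /midpoint; case: D t n => [? ?] [? ?] [? ?].
  by congr (_, _); rewrite /= -![_ *: _]/(_ * _); field.
(* At s = L/2 the offset is at most m sqrt 2 / 2 <= 1/8 in units of [h]. *)
have wh : `|w s / h| <= 5^-1.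
  rewrite normrM normfV (gtr0_norm h_gt0) ler_pdivrMr //.
  have : m * s <= m * (Num.sqrt 2 * h / 2) by rewrite ler_wpM2l // sE ler_wpM2r // invr_ge0.
  have : m * (4 * Num.sqrt 2) * h <= 1 * h by rewrite ler_wpM2r // ltW.
  by move: ampl h_gt0 => ? ? ? ?; lra.
have wl (z : R) : `|z| <= 1 -> `|z * (w s / h)| <= 5^-1.
  by move=> z1; rewrite normrM -[leRHS]mul1r ler_pM.
have [tau tauE [nF1 nF2]] := tilted_normal T n nn t nF _ tt tn nFt.
rewrite (flux_ref Defs.Bilinear h T D n F nF h_gt0 q qE) ref_grad_bilin /= nF1 nF2.
rewrite !(mulrCA _ (dot nF n)) -mulrDr pmulr_rge0 //.
have [Dx Dy] := elt_ref_square _ _ _ h_gt0 _ TF.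
apply: (bilin_ge0 _ _ _ _ _ (ref_coord h T D).1 (ref_coord h T D).2
  (ref_coord h T E).1 (ref_coord h T E).2) => //.
- by rewrite tauE; exact: le_trans m5.
- exact: boundary_ref_square bD.
- exact: boundary_ref_square bE.
- apply/negP => /eqP [DE1 DE2].
  have DE : D = E by rewrite (ref_coordE h T h_gt0 D) (ref_coordE h T h_gt0 E) DE1 DE2.
  move: ED; rewrite -DE subrr => /(congr1 (dot t)); rewrite dotZr tt mulr1.
  by rewrite /dot /= !mulr0 addr0 => /esym/eqP; rewrite gt_eqF.
- exact: ref_level_D.
- by rewrite EE; exact: ref_level_foot.
- rewrite FE' ref_coord_shift ref_coord_midpoint //= addrAC subrr add0r.
  have -> : sgx T * (w s *: n).1 / h = lev1 T n * (w s / h).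
    by rewrite /lev1 /= -![_ *: _]/(_ * _); ring.
  by apply: wl; exact: lev1_le.
- rewrite FE' ref_coord_shift ref_coord_midpoint //= addrAC subrr add0r.
  have -> : sgy T * (w s *: n).2 / h = lev2 T n * (w s / h).
    by rewrite /lev2 /= -![_ *: _]/(_ * _); ring.
  by apply: wl; exact: lev2_le.
Qed.

Lemma flux_rot (q : 'rV[R]_(nloc RotatedQ1)) :
  elt_set RotatedQ1 h T D -> elt_set RotatedQ1 h T E -> elt_set RotatedQ1 h T F ->
  (forall i : 'I_(nloc RotatedQ1), peval q (node h T i) = neg_part (dot n (node h T i - D))) ->
  - (7 / 2 * m) * dot nF n <= dot (grad (peval q) F) nF.
Proof.
move=> TD TE TF qE; have h0 := lt0r_neq0 h_gt0.
have [tau tauE [nF1 nF2]] := tilted_normal T n nn t nF _ tt tn nFt.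
rewrite (flux_ref RotatedQ1 h T D n F nF h_gt0 q qE) ref_grad_rot /= nF1 nF2.
rewrite !(mulrCA _ (dot nF n)) -mulrDr [leLHS]mulrC ler_pM2l //.
(* The foot of [F] on DE lies in [T] by convexity, which bounds the point (x0, y0) of [rot_ge]. *)
pose Z := D + s *: t.
have TZ : elt_set RotatedQ1 h T Z.
  have -> : Z = D + (s / L) *: (E - D).
    have -> : E - D = L *: t by rewrite EE addrC addKr.
    by rewrite scalerA divfK // gt_eqF.
  apply/elt_setP => // i; rewrite edge_form_affine.
  have /andP[s0 sL] := s0L.
  have c0 : 0 <= s / L by rewrite divr_ge0 // ltW.
  have c1 : 0 <= 1 - s / L by rewrite subr_ge0 ler_pdivrMr // mul1r.
  have fD := (elt_setP _ _ _ _ h0).1 TD i; have fE := (elt_setP _ _ _ _ h0).1 TE i.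
  by rewrite addr_ge0 // mulr_ge0.
have FZ : F = Z + w s *: n by rewrite FE.
have [Fx Fy] := elt_ref_square _ _ _ h_gt0 _ TF.
have [Zx Zy] := elt_ref_square _ _ _ h_gt0 _ TZ.
have half (z : R) : 0 <= z <= 1 -> `|z - 2^-1| <= 2^-1.
  by move=> /andP[? ?]; rewrite ler_norml; apply/andP; split; lra.
have lZ := ref_level_foot s; rewrite -/Z in lZ.
apply: (le_trans _ (rot_ge _ _ _ _ _ ((ref_coord h T Z).1 - 2^-1)
  ((ref_coord h T Z).2 - 2^-1) (w s / h) tau (3 / 2 * m) m _ _ _ _ _ _ _ _ _ _)).
- by lra.
- exact: lev_unit.
- rewrite FZ ref_coord_shift /= /lev1 -![_ *: _]/(_ * _); ring.
- rewrite FZ ref_coord_shift /= /lev2 -![_ *: _]/(_ * _); ring.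
- by rewrite -lZ; field.
- exact: half.
- exact: half.
- exact: half.
- exact: half.
- by have := amplitude_le; lra.
- by rewrite tauE.
Qed.

(** 4 (1 - rho) = (4 - (3 + lam) rho) - (1 - lam) rho, so the left side is at most rho (1 - lam),
    which is below rho. *)
Lemma rot_restriction (rho lam : R) : 0 <= m -> 0 < rho <= 1 -> 0 < lam < 1 ->
  m <= rho * (1 - lam) / (4 - (3 + lam) * rho) -> 4 * m * (1 - rho) < rho.
Proof.
move=> m0 /andP[r0 r1] /andP[l0 l1].
have lr : (3 + lam) * rho <= 3 + lam by rewrite ler_piMr //; lra.
rewrite ler_pdivlMr; last by lra.
have : 0 <= m * ((1 - lam) * rho) by rewrite !mulr_ge0 // ?ltW // subr_gt0.
have : 0 < rho * lam by rewrite mulr_gt0.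
by move=> ? ? ?; lra.
Qed.

Lemma transmission_pos (fam : fe_family) (bm bp kbar : R) (q : 'rV[R]_(nloc fam)) :
  0 < bm -> bm <= bp -> m = Num.sqrt kbar -> kbar_restriction fam (bm / bp) kbar ->
  elt_boundary fam h T D -> elt_boundary fam h T E -> elt_set fam h T F ->
  admissible_F fam D E n F nF ->
  (forall i : 'I_(nloc fam), peval q (node h T i) = neg_part (dot n (node h T i - D))) ->
  0 < bm * dot n nF + (bp - bm) * dot (grad (peval q) F) nF.
Proof.
move=> bm0 bmp mE restr bD bE TF adm qE.
have bp0 : 0 <= bp - bm by rewrite subr_ge0.
have nneg : 0 <= dot (grad (peval q) F) nF ->
    0 < bm * dot n nF + (bp - bm) * dot (grad (peval q) F) nF.
  by move=> g0; rewrite ltr_wpDr ?mulr_ge0 // mulr_gt0 // dotC.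
have lin : fam = LinearP1 \/ fam = CrouzeixRaviart -> nF = n ->
    0 <= dot (grad (peval q) F) nF.
  move=> fE nFE; rewrite (flux_ref fam h T D n F nF h_gt0 q qE) nFE.
  exact: ref_grad_mono.
case: fam q restr bD bE TF adm qE nneg lin => q restr bD bE TF adm qE nneg lin.
- by apply: nneg; apply: lin => //; left.
- by apply: nneg; apply: lin => //; right.
- by apply: nneg; apply: flux_bilin => //; rewrite mE.
have h0 := lt0r_neq0 h_gt0.
have := flux_rot q (boundary_elt _ _ _ h0 _ bD) (boundary_elt _ _ _ h0 _ bE) TF qE.
move: restr => [lam lam01]; rewrite -mE => restr.
have m0 : 0 <= m by rewrite mE sqrtr_ge0.
have bp_gt0 : 0 < bp by exact: lt_le_trans bmp.
have rho01 : 0 < bm / bp <= 1 by rewrite divr_gt0 //= ler_pdivrMr // mul1r.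
(* Multiplied by [bp] this gives 4 m (bp - bm) < bm, so K >= (bm - (7/2) m (bp - bm)) (n . nF) >
   0. *)
have := rot_restriction (bm / bp) lam m0 rho01 lam01 restr.
rewrite -(ltr_pM2r bp_gt0) divfK ?gt_eqF //.
have -> : 4 * m * (1 - bm / bp) * bp = 4 * m * (bp - bm).
  by field; exact: lt0r_neq0.
move=> mb /(ler_wpM2l bp0).
move: (dot (grad _ F) nF) => g gl; rewrite dotC.
have mb0 : 0 <= m * (bp - bm) * dot nF n by rewrite !mulr_ge0 // ltW.
move: mb; rewrite -(ltr_pM2r nF0) => mb.
by lra.
Qed.
End FluxBounds.

Theorem theorem5p1 (R : realType) (fam : fe_family)
    (Omega Gamma Om Op : set (R * R)) (h : R) (G : R * R)
    (Th : seq (R * R * bool * bool)) (kappa bm bp eps kbar : R)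
    (T : R * R * bool * bool) (D E nbar F nF : R * R)
    (v : 'rV[R]_(nloc fam)) :
  rectangular_domain Omega ->
  separates Gamma Omega Om Op ->
  cartesian_mesh fam h G Omega Th ->
  interface_hypotheses fam h Gamma Th ->
  max_curvature Gamma kappa ->
  0 < bm -> bm <= bp ->
  0 < eps < Num.sqrt 2 / 2 ->
  0 < kbar <= 1 ->
  smallness h eps kbar kappa ->
  kbar_restriction fam (bm / bp) kbar ->
  T \in Th -> interface_element fam h Gamma T ->
  cuts_at fam h Gamma T D E ->
  oriented_line_normal fam h Gamma Om Op T D E nbar ->
  Gamma F -> elt_set fam h T F ->
  unit_normal (Gamma `&` elt_set fam h T) F nF ->
  (* the normals to Gamma in T are oriented like nbar *)
  0 < dot nF nbar ->
  admissible_F fam D E nbar F nF ->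
  exists! phi : 'rV[R]_(nloc fam) * 'rV[R]_(nloc fam),
    ife_function h bm bp Om T D E F nF v phi.
Proof.
move=> _ sep mesh hyp curv bm0 bmp eps2 kbar1 small restr TTh Tint cut orient gF TF
  nF_normal nF0 adm.
have h_gt0 : 0 < h by case: mesh.
have h0 := lt0r_neq0 h_gt0.
have nn : dot nbar nbar = 1 by case: orient.
have [t [L [w [tt tn EE gr]]]] := interface_frame fam h Gamma Om Op Th T D E nbar
  hyp TTh Tint cut orient.
have [_ _ L0 wC2 GT] := gr.
have [posOp negOm disj] := interface_sides fam h Omega Gamma Om Op G Th T D E t nbar L w
  sep mesh TTh Tint cut orient tt tn EE gr.
apply: (ife_unisolvent fam h bm bp L T Om D E t nbar F nF h0 tt nn tn L0 EE) => [i Oi|i Oi|q qE].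
(* Nodes lie on the boundary of [T], where a strict sign of the level decides the subdomain; both
   sign conditions follow by contraposition. *)
- rewrite leNgt; apply/negP => ni; apply: (disj _ Oi).
  by apply: posOp ni; exact: node_boundary.
- rewrite leNgt; apply/negP => ni; apply: Oi.
  by apply: negOm ni; exact: node_boundary.
have [s0L FE] := graph_at fam h T Gamma D t nbar L w tt nn tn GT F gF TF.
set s := dot t (F - D) in s0L FE.
have [slope L_le ampl] := interface_slope fam h T h_gt0 Gamma D E t nbar L eps kbar kappa w
  cut tt EE gr curv eps2 kbar1 small.
have [bD bE] : elt_boundary fam h T D /\ elt_boundary fam h T E.
  by split; [case: (cut_D _ _ _ _ _ _ cut) | case: (cut_E _ _ _ _ _ _ cut)].
have dw : derivable w s 1 by case: wC2 => wd _; case: (wd s).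
have nFt := unit_normal_graph (Gamma `&` elt_set fam h T) D t nbar F nF L s w
  tt nn tn L0 dw GT s0L FE nF_normal.
exact: (transmission_pos h T D E t nbar F nF L s (Num.sqrt kbar) w h_gt0 tt nn tn L0 EE
  s0L FE nF0 nFt (slope s s0L) (ampl s s0L) L_le fam bm bp kbar q bm0 bmp erefl restr
  bD bE TF adm qE).
Qed.
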